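(* Let $\Gamma$ be a group with identity $\varepsilon$, let $\Gamma_1$ be a normal subgroup of $\Gamma$, and let $\mathcal A$ be a collection of subgroups of $\Gamma$ such that $\{\Gamma_1\}\cup\mathcal A$ is a partition of $\Gamma$ (every non-identity element of $\Gamma$ lies in exactly one member of $\{\Gamma_1\}\cup\mathcal A$), each $A\in\mathcal A$ is malnormal, and every conjugate of every $A\in\mathcal A$ belongs to $\mathcal A$. Let $(G,\psi)$ be a $\Gamma$-gain graph. Then $\mathcal C(\Gamma,\Gamma_1,\mathcal A,G,\psi)$ is a linear class of circuits of the frame matroid $F(G,\psi/\Gamma_1)$. Consequently, the function on subsets $X\subseteq E(G)$ given by $r_N(X)$ if every circuit of $N|X$ lies in $\mathcal C(\Gamma,\Gamma_1,\mathcal A,G,\psi)$ and by $r_N(X)+1$ otherwise (where $N=F(G,\psi/\Gamma_1)$) is the rank function of a matroid $M(\Gamma,\Gamma_1,\mathcal A,G,\psi)$ on $E(G)$ which is an elementary lift of $F(G,\psi/\Gamma_1)$.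
   Context: Graphs are finite and may have loops and parallel edges. For $X\subseteq E(G)$, $G[X]$ is the subgraph with edge set $X$ and vertex set the vertices incident with edges of $X$. An oriented edge is a triple $(e,u,v)$ with $e$ an edge with ends $u,v$ ($u=v$ for a loop). A $\Gamma$-gain function on $G$ is a map $\psi$ from oriented edges to $\Gamma$ with $\psi(e,u,v)=\psi(e,v,u)^{-1}$ whenever $u\ne v$; $(G,\psi)$ is then a $\Gamma$-gain graph. For a walk $W=v_1,e_1,v_2,\dots,e_k,v_{k+1}$, $\psi(W)=\psi(e_1,v_1,v_2)\cdots\psi(e_k,v_k,v_{k+1})$. A cycle (loops and pairs of parallel edges count as cycles) is $\psi$-balanced if some simple closed walk $W$ around it has $\psi(W)=\varepsilon$. For an edge $e$ with ends $u,v$, $\psi(e)=\{\psi(e,u,v),\psi(e,v,u)\}$, and $\psi(X)=\bigcup_{e\in X}\psi(e)$. A switching function is a map $\eta:V(G)\to\Gamma$, and $\psi^\eta(e,u,v)=\eta(u)^{-1}\psi(e,u,v)\eta(v)$. The map $\psi/\Gamma_1$ is the $(\Gamma/\Gamma_1)$-gain function obtained by composing $\psi$ with the quotient map. A subgroup $A$ is malnormal if $\gamma^{-1}A\gamma\cap A=\{\varepsilon\}$ for all $\gamma\in\Gamma\setminus A$. A theta graph is the union of three internally vertex-disjoint paths between two distinct vertices; a tight handcuff is the union of two edge-disjoint cycles with exactly one common vertex; a loose handcuff is the union of two vertex-disjoint cycles and a minimal path joining them. For a gain graph $(G,\varphi)$ over any group, the frame matroid $F(G,\varphi)$ is the matroid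 on $E(G)$ whose circuits are the $\varphi$-balanced cycles, the tight and loose handcuffs both of whose cycles are unbalanced, and the theta graphs all three of whose cycles are unbalanced; its rank function is $r(X)=|V(G[X])|-b(X)$, where $b(X)$ is the number of components of $G[X]$ all of whose cycles are balanced. $\mathcal C(\Gamma,\Gamma_1,\mathcal A,G,\psi)$ denotes the set of circuits $C$ of $F(G,\psi/\Gamma_1)$ such that either $C$ is a $\psi$-balanced cycle, or $C$ is a handcuff or a theta graph and there exist a switching function $\eta$ and $A\in\mathcal A$ with $\psi^\eta(C)\subseteq A$. A set $\mathcal C$ of circuits of a matroid $N$ is a linear class if whenever $C_1,C_2\in\mathcal C$ satisfy $|C_1\cup C_2|-r_N(C_1\cup C_2)=2$, every circuit of $N$ contained in $C_1\cup C_2$ belongs to $\mathcal C$. A matroid $M$ is an elementary lift of $N$ if there is a matroid $K$ with an element $e$ such that $K\setminus e=M$ and $K/e=N$. (It is a known result that for any linear class $\mathcal C$ of $N$, the displayed function is the rank function of an elementary lift of $N$.) *)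

(* Defs.v *)
From HB Require Import structures.
From mathcomp Require Import boolp classical_sets.
From mathcomp Require Import all_boot.

Set Implicit Arguments.
Unset Strict Implicit.
Unset Printing Implicit Defensive.

Local Open Scope group_scope.
Local Open Scope quotient_scope.

Section Subgroups.
Variable Gam : groupType.

Definition is_subgroup (A : set Gam) : Prop :=
  [/\ A 1, forall x y, A x -> A y -> A (x * y) & forall x, A x -> A x^-1].

(* The conjugate g^-1 A g. *)
Definition conj_set (A : set Gam) (g : Gam) : set Gam :=
  [set a ^ g | a in A]%classic.

Definition malnormal (A : set Gam) : Prop :=
  forall g, ~ A g -> (conj_set A g `&` A = [set 1])%classic.

Record normal_subgroup := NormalSubgroup {
  normal_set :> set Gam;
  normal_is_subgroup : is_subgroup normal_set;
  normal_conj : forall x g, normal_set x -> normal_set (x ^ g) }.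

(* Every non-identity element lies in exactly one member of P. *)
Definition group_partition (P : set (set Gam)) : Prop :=
  forall g, g <> 1 -> exists! A : set Gam, P A /\ A g.

End Subgroups.

Section QuotientGroup.
Variables (Gam : groupType) (H : normal_subgroup Gam).

Definition coset_rel (x y : Gam) : bool := `[< normal_set H (x^-1 * y) >].

Lemma coset_rel_equiv : equiv_class_of coset_rel.
Proof.
have [H1 HM HV] := normal_is_subgroup H.
split=> [x|x y|y x z].
- by apply/asboolP; rewrite mulVg.
- by apply/asboolP/asboolP => /HV; rewrite invgM invgK.
- move=> /asboolP xy /asboolP yz; apply/asboolP.
  by have := HM _ _ xy yz; rewrite mulgA mulgK.
Qed.

Canonical coset_equiv := EquivRelPack coset_rel_equiv.

Definition quotient_group := {eq_quot coset_rel}.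

HB.instance Definition _ := Choice.on quotient_group.
HB.instance Definition _ := EqQuotient.on quotient_group.

Definition quotient_map (x : Gam) : quotient_group := \pi_quotient_group x.

Lemma quotient_ind (P : quotient_group -> Prop) :
  (forall x, P (quotient_map x)) -> forall q, P q.
Proof. exact: quotW. Qed.

Let qmul (x y : quotient_group) := quotient_map (repr x * repr y).
Let qinv (x : quotient_group) := quotient_map (repr x)^-1.

Lemma quotient_mapP x y :
  quotient_map x = quotient_map y <-> normal_set H (x^-1 * y).
Proof. by split=> [/eqquotP/asboolP|h] //; apply/eqquotP/asboolP. Qed.

Lemma repr_quotient_map x : normal_set H ((repr (quotient_map x))^-1 * x).
Proof. by apply/quotient_mapP; rewrite /quotient_map reprK. Qed.

Let qmulE x y : qmul (quotient_map x) (quotient_map y) = quotient_map (x * y).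
Proof.
have [H1 HM HV] := normal_is_subgroup H.
apply/quotient_mapP.
have hx := repr_quotient_map x; have hy := repr_quotient_map y.
set a := repr _ in hx *; set b := repr (quotient_map y) in hy *.
have := HM _ _ (normal_conj b hx) hy.
by rewrite /conjg invgM !mulgA mulgK.
Qed.

Let qinvE x : qinv (quotient_map x) = quotient_map x^-1.
Proof.
have [H1 HM HV] := normal_is_subgroup H.
apply/quotient_mapP; have hx := repr_quotient_map x; set a := repr _ in hx *.
have := normal_conj (a^-1) (HV _ hx).
by rewrite /conjg invgM !invgK !mulgA mulgK.
Qed.

Let qmulA : associative qmul.
Proof. by elim/quotient_ind=> x; elim/quotient_ind=> y; elim/quotient_ind=> z; rewrite !qmulE mulgA. Qed.
Let qmul1 : left_id (quotient_map 1) qmul.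
Proof. by elim/quotient_ind=> x; rewrite qmulE mul1g. Qed.
Let qmulr1 : right_id (quotient_map 1) qmul.
Proof. by elim/quotient_ind=> x; rewrite qmulE mulg1. Qed.
Let qmulV : left_inverse (quotient_map 1) qinv qmul.
Proof. by elim/quotient_ind=> x; rewrite qinvE qmulE mulVg. Qed.
Let qmulrV : right_inverse (quotient_map 1) qinv qmul.
Proof. by elim/quotient_ind=> x; rewrite qinvE qmulE mulgV. Qed.

HB.instance Definition _ := isGroup.Build quotient_group
  qmulA qmul1 qmulr1 qmulV qmulrV.

Lemma quotient_mapM x y : quotient_map (x * y) = quotient_map x * quotient_map y.
Proof. by rewrite -qmulE. Qed.

Lemma quotient_mapV x : quotient_map x^-1 = (quotient_map x)^-1.
Proof. by rewrite -qinvE. Qed.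

End QuotientGroup.

Record mgraph := MGraph {
  vertex : finType;
  edge : finType;
  ends : edge -> {set vertex};
  ends_card : forall e, 0 < #|ends e| <= 2 }.

Definition oedge (G : mgraph) : Type :=
  {x : edge G * vertex G * vertex G | ends x.1.1 == [set x.1.2; x.2]}.
HB.instance Definition _ (G : mgraph) := Finite.on (oedge G).

Section Graphs.
Variable G : mgraph.
Local Notation V := (vertex G).
Local Notation E := (edge G).
Implicit Types (X C : {set E}) (o : oedge G) (w : seq (oedge G)) (u v : V).

Definition oe o : E := (val o).1.1.
Definition src o : V := (val o).1.2.
Definition tgt o : V := (val o).2.

Lemma ends_oe o : ends (oe o) = [set src o; tgt o].
Proof. exact/eqP/(valP o). Qed.

Lemma orev_subproof o : ends (oe o) == [set tgt o; src o].
Proof. by rewrite setUC ends_oe. Qed.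

Definition orev o : oedge G :=
  exist (fun x : E * V * V => ends x.1.1 == [set x.1.2; x.2])
    (oe o, tgt o, src o) (orev_subproof o).

(* V(G[X]) *)
Definition verts X : {set V} := \bigcup_(e in X) ends e.

Definition adj X : rel V := [rel u v | [exists e in X, ends e == [set u; v]]].

(* Vertex sets of the components of G[X]. *)
Definition components X : {set {set V}} :=
  equivalence_partition (connect (adj X)) (verts X).

(* A walk with at least one edge is given by its sequence of oriented edges. *)
Definition consecutive : rel (oedge G) := [rel o o' | tgt o == src o'].

Definition wedges w : {set E} := [set e in map oe w].

(* In a closed walk of length 2 distinctness of the edges does not follow from
   that of the vertices. *)
Definition simple_closed_walk w C : Prop :=
  [/\ w != [::], cycle consecutive w, uniq (map src w), uniq (map oe w)
    & wedges w = C].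

Definition is_cycle C : Prop := exists w, simple_closed_walk w C.

Fixpoint is_walk u v w : bool :=
  if w is o :: w' then (src o == u) && is_walk (tgt o) v w' else u == v.

Definition is_path u v w : bool := is_walk u v w && uniq (u :: map tgt w).

Definition wverts u w : {set V} := [set x in u :: map tgt w].

(* Edge-disjointness rules out using the same one-edge path twice. *)
Definition is_theta C : Prop :=
  exists u v w1 w2 w3, [/\ u != v,
    [/\ is_path u v w1, is_path u v w2 & is_path u v w3],
    [/\ wverts u w1 :&: wverts u w2 = [set u; v],
        wverts u w1 :&: wverts u w3 = [set u; v]
      & wverts u w2 :&: wverts u w3 = [set u; v]],
    [/\ [disjoint wedges w1 & wedges w2], [disjoint wedges w1 & wedges w3]
      & [disjoint wedges w2 & wedges w3]]
    & C = wedges w1 :|: wedges w2 :|: wedges w3].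

Definition is_tight_handcuff C : Prop :=
  exists C1 C2, [/\ is_cycle C1, is_cycle C2, [disjoint C1 & C2],
    #|verts C1 :&: verts C2| = 1%N & C = C1 :|: C2].

Definition is_loose_handcuff C : Prop :=
  exists C1 C2 u v w, [/\ is_cycle C1 /\ is_cycle C2,
    [disjoint verts C1 & verts C2], is_path u v w,
    verts C1 :&: wverts u w = [set u] /\ verts C2 :&: wverts u w = [set v]
    & C = C1 :|: C2 :|: wedges w].

Definition is_handcuff C : Prop := is_tight_handcuff C \/ is_loose_handcuff C.

End Graphs.

Arguments oe {G} o.
Arguments src {G} o.
Arguments tgt {G} o.
Arguments orev {G} o.
Arguments consecutive {G}.

Record gain (Gam : groupType) (G : mgraph) := Gain {
  gain_val :> oedge G -> Gam;
  gain_orev : forall o, src o <> tgt o -> gain_val o = (gain_val (orev o))^-1 }.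

Section GainGraphs.
Variables (Gam : groupType) (G : mgraph).
Implicit Types (psi : gain Gam G) (X C : {set edge G}).

Definition walk_gain psi (w : seq (oedge G)) : Gam := \prod_(o <- w) psi o.

Definition balanced psi C : Prop :=
  exists2 w, simple_closed_walk w C & walk_gain psi w = 1.

Definition gain_image psi X : set Gam :=
  [set psi o | o in [set o : oedge G | oe o \in X]]%classic.

Lemma switch_subproof psi (eta : vertex G -> Gam) (o : oedge G) :
  src o <> tgt o ->
  (eta (src o))^-1 * psi o * eta (tgt o) =
  ((eta (src (orev o)))^-1 * psi (orev o) * eta (tgt (orev o)))^-1.
Proof. by move=> /gain_orev ->; rewrite !invgM invgK mulgA. Qed.

Definition switch psi (eta : vertex G -> Gam) : gain Gam G :=
  Gain (switch_subproof psi eta).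

Lemma quotient_gain_subproof (H : normal_subgroup Gam) psi (o : oedge G) :
  src o <> tgt o ->
  quotient_map H (psi o) = (quotient_map H (psi (orev o)))^-1.
Proof. by move=> /gain_orev ->; rewrite quotient_mapV. Qed.

Definition quotient_gain psi (H : normal_subgroup Gam) :
    gain (quotient_group H) G :=
  Gain (@quotient_gain_subproof H psi).

(* |V(G[X])| - b(X), with b(X) the number of components of G[X] all of whose
   cycles are balanced. *)
Definition frame_rank psi X : nat :=
  #|verts X| -
  #|[set B in components X |
      `[< forall C, C \subset X -> verts C \subset B ->
            is_cycle C -> balanced psi C >]]|.

End GainGraphs.

Record matroid (E : finType) := Matroid {
  rank : {set E} -> nat;
  rank_le_card : forall X : {set E}, rank X <= #|X|;
  rank_mono : forall X Y : {set E}, X \subset Y -> rank X <= rank Y;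
  rank_submod : forall X Y : {set E},
    rank (X :|: Y) + rank (X :&: Y) <= rank X + rank Y }.

Section Matroids.
Variable E : finType.
Implicit Types (M N : matroid E) (X C : {set E}) (CC : set {set E}).

Definition dependent M X : bool := rank M X < #|X|.

Definition circuit M C : bool := minset (dependent M) C.

Definition linear_class N CC : Prop :=
  (forall C, CC C -> circuit N C) /\
  forall C1 C2, CC C1 -> CC C2 -> #|C1 :|: C2| = (rank N (C1 :|: C2) + 2)%N ->
    forall C, circuit N C -> C \subset C1 :|: C2 -> CC C.

(* The circuits of N|X are the circuits of N contained in X. *)
Definition lift_rank N CC X : nat :=
  if `[< forall C, circuit N C -> C \subset X -> CC C >]
  then rank N X else (rank N X).+1.

End Matroids.

Section SingleElementMinors.
Variables (E : finType) (K : matroid (option E)).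
Implicit Types X Y : {set E}.

Let up X : {set option E} := [set Some x | x in X].

Let upU X Y : up (X :|: Y) = up X :|: up Y.
Proof. exact: imsetU. Qed.

Let upI X Y : up (X :&: Y) = up X :&: up Y.
Proof. by apply: imsetI => x y _ _ []. Qed.

Let card_up X : #|up X| = #|X|.
Proof. by apply: card_imset => x y []. Qed.

Lemma delete_le_card X : rank K (up X) <= #|X|.
Proof. by rewrite -card_up rank_le_card. Qed.

Lemma delete_mono X Y : X \subset Y -> rank K (up X) <= rank K (up Y).
Proof. by move=> sXY; apply: rank_mono; apply: imsetS. Qed.

Lemma delete_submod X Y :
  rank K (up (X :|: Y)) + rank K (up (X :&: Y)) <= rank K (up X) + rank K (up Y).
Proof. by rewrite upU upI rank_submod. Qed.

(* K \ e, where e is the element None of K. *)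
Definition delete_None : matroid E :=
  Matroid delete_le_card delete_mono delete_submod.

Lemma contract_le_card X : rank K (None |: up X) - rank K [set None] <= #|X|.
Proof.
rewrite leq_subLR -card_up.
apply: leq_trans (leq_trans (leq_addr _ _) (rank_submod K _ _)) _.
by rewrite leq_add2l rank_le_card.
Qed.

Lemma contract_mono X Y : X \subset Y ->
  rank K (None |: up X) - rank K [set None] <=
  rank K (None |: up Y) - rank K [set None].
Proof.
by move=> sXY; apply: leq_sub2r; apply: rank_mono; apply/setUS/imsetS.
Qed.

Lemma contract_submod X Y :
  (rank K (None |: up (X :|: Y)) - rank K [set None]) +
  (rank K (None |: up (X :&: Y)) - rank K [set None]) <=
  (rank K (None |: up X) - rank K [set None]) +
  (rank K (None |: up Y) - rank K [set None]).
Proof.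
have le Z : rank K [set None] <= rank K (None |: up Z).
  by apply: rank_mono; apply: subsetUl.
have sub := rank_submod K (None |: up X) (None |: up Y).
rewrite -setUUr -setUIr -upU -upI in sub.
rewrite -(leq_add2r (rank K [set None] + rank K [set None])).
by rewrite addnACA !subnK // [leqRHS]addnACA !subnK.
Qed.

(* K / e, where e is the element None of K. *)
Definition contract_None : matroid E :=
  Matroid contract_le_card contract_mono contract_submod.

End SingleElementMinors.

(* The ground set of K is E together with one further element, None. *)
Definition elementary_lift (E : finType) (M N : matroid E) : Prop :=
  exists K : matroid (option E),
    rank (delete_None K) =1 rank M /\ rank (contract_None K) =1 rank N.

Lemma finset_ind (E : finType) (P : {set E} -> Prop) :
  P set0 -> (forall z (Z : {set E}), z \notin Z -> P Z -> P (z |: Z)) -> forall Z, P Z.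
Proof.
move=> P0 PS Z; have [n] := ubnP #|Z|; elim: n Z => // n IH Z leZ.
case: (set_0Vmem Z) => [->//|[z zZ]]; rewrite -(setD1K zZ).
apply: PS; first by rewrite !inE eqxx.
by apply: IH; move: leZ; rewrite (cardsD1 z Z) zZ.
Qed.

(* A function whose unit increments are governed by a monotone closure is a
   matroid rank function; below this yields the axioms for frame_rank. *)
Section RankOfClosure.
Variables (E : finType) (r : {set E} -> nat) (cl : {set E} -> E -> bool).
Hypothesis r0 : r set0 = 0.
Hypothesis rS : forall (X : {set E}) e, e \notin X -> r (e |: X) = r X + ~~ cl X e.
Hypothesis cl_mono : forall (X Y : {set E}) e, X \subset Y -> cl X e -> cl Y e.

Lemma closure_rank_incr (X Y Z : {set E}) : X \subset Y ->
  r X <= r (X :|: Z) <= r X + #|Z| /\ r (Y :|: Z) + r X <= r Y + r (X :|: Z).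
Proof.
move=> sXY; elim/finset_ind: Z => [|z Z nzZ [/andP[IH1 IH2] IH3]].
  by rewrite cards0 !setU0 addn0 leqnn addnC leqnn.
have := @rS (X :|: Z) z; have := @rS (Y :|: Z) z.
rewrite (setUCA X) (setUCA Y) cardsU1 nzZ.
have sXZ : X :|: Z \subset Y :|: Z by exact: setSU.
have := @cl_mono _ _ z sXZ.
have step (A : {set E}) : z \in A -> z |: A = A.
  by move=> zA; apply/setUidPr; rewrite sub1set.
have [zX|zX] := boolP (z \in X :|: Z).
  rewrite (subsetP sXZ _ zX) !step ?(subsetP sXZ _ zX) // => _ _ _.
  by split=> //; rewrite IH1 (leq_trans IH2) // leq_add2l leqnSn.
have [zY|zY] := boolP (z \in Y :|: Z).
  move=> _ _ ->//; rewrite step //; split; last first.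
    by rewrite (leq_trans IH3) // leq_add2l leq_addr.
  rewrite (leq_trans IH1) ?leq_addr //= (leq_trans (leq_add IH2 (leq_b1 _))) //.
  by rewrite -addnA [#|Z| + _]addnC.
move=> clM -> // -> //; split.
  rewrite (leq_trans IH1) ?leq_addr //= (leq_trans (leq_add IH2 (leq_b1 _))) //.
  by rewrite -addnA [#|Z| + _]addnC.
rewrite addnAC addnA leq_add //; case: (cl (X :|: Z) z) clM => [->//|_].
exact: leq_b1.
Qed.

Lemma closure_rank_le_card (X : {set E}) : r X <= #|X|.
Proof.
have [/andP[_ le _]] := @closure_rank_incr set0 set0 X (subxx _).
by move: le; rewrite set0U r0.
Qed.

Lemma closure_rank_mono (X Y : {set E}) : X \subset Y -> r X <= r Y.
Proof.
move=> sXY; have [/andP[le _] _] := @closure_rank_incr X X Y (subxx _).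
by move: le; rewrite (setUidPr sXY).
Qed.

Lemma closure_rank_submod (X Y : {set E}) :
  r (X :|: Y) + r (X :&: Y) <= r X + r Y.
Proof.
have [_] := @closure_rank_incr (X :&: Y) Y X (subsetIr _ _).
by rewrite setUC (setUidPr (subsetIl _ _)) [r X + _]addnC.
Qed.

End RankOfClosure.

Section OrientedEdges.
Variable G : mgraph.
Local Notation V := (vertex G).
Implicit Types (X Y C : {set edge G}) (o : oedge G) (S : {set V}).

Lemma orev_loop o : src o = tgt o -> orev o = o.
Proof.
case: o => [[[e u] v] h]; rewrite /src /tgt /= => uv; apply: val_inj.
by rewrite /= /oe /src /tgt /= uv.
Qed.

Lemma oedge_ext o o' : oe o = oe o' -> src o = src o' -> tgt o = tgt o' -> o = o'.
Proof.
move=> he hs ht; apply: val_inj.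
by move: he hs ht; rewrite /oe /src /tgt; case: (val o) (val o') => [[? ?] ?]
  [[? ?] ?] /= -> -> ->.
Qed.

Lemma oe_eq o o' : oe o' = oe o -> o' = o \/ o' = orev o.
Proof.
move=> eqe; have := ends_oe o'; rewrite eqe ends_oe => /setP eqS.
have := eqS (src o); have := eqS (tgt o).
have := eqS (src o'); have := eqS (tgt o'); rewrite !inE !eqxx /= ?orbT => {eqS}.
move=> /orP[]/eqP ht /orP[]/eqP hs; rewrite ht hs ?orbb.
- by move=> /esym/eqP hto _; left; apply: oedge_ext; rewrite // ht hto.
- by move=> _ _; right; apply: oedge_ext.
- by move=> _ _; left; apply: oedge_ext.
- by move=> _ /esym/eqP hso; left; apply: oedge_ext; rewrite // hs hso.
Qed.

Lemma oe_surj (e : edge G) : exists o, oe o = e.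
Proof.
have /andP[gt0 le2] := ends_card e.
suff [u [v uv]] : exists u v, ends e == [set u; v].
  by exists (exist (fun x : edge G * V * V => ends x.1.1 == [set x.1.2; x.2])
    (e, u, v) uv).
move: le2; rewrite leq_eqVlt ltnS => /orP[/cards2P[u [v [_ ->]]]|le1].
  by exists u, v.
have /cards1P[u ->] : #|ends e| == 1%N by rewrite eqn_leq le1.
by exists u, u; rewrite setUid.
Qed.

Lemma adjP X u v :
  reflect (exists o, [/\ oe o \in X, src o = u & tgt o = v]) (adj X u v).
Proof.
apply: (iffP exists_inP) => [[e eX uv]|[o [oX <- <-]]].
  by exists (exist (fun x : edge G * V * V => ends x.1.1 == [set x.1.2; x.2])
    (e, u, v) uv).
by exists (oe o) => //; rewrite ends_oe.
Qed.

Lemma adj_sym X : symmetric (adj X).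
Proof.
by move=> u v; apply/exists_inP/exists_inP => -[e eX /eqP h]; exists e => //;
   rewrite h setUC.
Qed.

Lemma connect_adj_sym X : connect_sym (adj X).
Proof. by apply: sym_connect_sym; apply: adj_sym. Qed.

Lemma connect_adj_mono X Y u v : X \subset Y ->
  connect (adj X) u v -> connect (adj Y) u v.
Proof.
move=> /subsetP sXY; apply: connect_sub => x y /adjP[o [oX <- <-]].
by apply/connect1/adjP; exists o; split; rewrite ?sXY.
Qed.

Definition vclass X u : {set V} := [set x | connect (adj X) u x].

Definition closed_under X S :=
  forall o, oe o \in X -> (src o \in S) = (tgt o \in S).

Lemma closed_vclass X u : closed_under X (vclass X u).
Proof.
move=> o oX; rewrite !inE.
have h : connect (adj X) (src o) (tgt o) by apply/connect1/adjP; exists o.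
by rewrite (same_connect_r (@connect_adj_sym X) h).
Qed.

Lemma closed_under_path X S u p : closed_under X S -> path (adj X) u p ->
  u \in S -> {subset u :: p <= S}.
Proof.
move=> clS; elim: p u => [|v p IH] u /= pP uS x.
  by rewrite inE => /eqP ->.
case/andP: pP => /adjP[o [oX ou ov]] pP; rewrite inE => /predU1P[->//|].
by apply: IH => //; rewrite -ov -clS // ou.
Qed.

Lemma src_verts o C : oe o \in C -> src o \in verts C.
Proof.
by move=> oC; apply/bigcupP; exists (oe o); rewrite // ends_oe !inE eqxx.
Qed.

(* Lifting a simple vertex path to oriented edges. *)
Lemma lift_path X u p : path (adj X) u p -> uniq (u :: p) ->
  exists w, [/\ all (fun o => oe o \in X) w, map src w = belast u p,
    map tgt w = p, (forall o, tgt o = u -> path consecutive o w)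
    & uniq (map oe w)].
Proof.
elim: p u => [|v p IH] u; first by exists [::].
move=> /= /andP[/adjP[o [oX ou ov]] pP] /andP[uN /[dup] un /IH].
move=> /(_ pP)[w [wX ws wt wc wu]]; exists (o :: w).
rewrite /= oX wX ou ov ws wt wu wc // andbT.
split=> //; first by move=> o' o'u; rewrite /consecutive /= o'u ou eqxx.
rewrite andbT; apply/mapP=> -[o' o'w eqe]; case/negP: uN.
have : u \in ends (oe o') by rewrite -eqe ends_oe ou !inE eqxx.
rewrite ends_oe !inE => /orP[]/eqP ->.
  have : src o' \in belast v p by rewrite -ws map_f.
  by move/mem_belast; rewrite inE.
have : tgt o' \in p by rewrite -wt map_f.
by move=> ->; rewrite orbT.
Qed.

End OrientedEdges.

Section Potentials.
Variables (Gam : groupType) (G : mgraph) (phi : gain Gam G).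
Local Notation V := (vertex G).
Implicit Types (X Y C : {set edge G}) (o : oedge G) (S : {set V}).
Implicit Types (eta : V -> Gam).

Definition consistent eta o := phi o = (eta (src o))^-1 * eta (tgt o).

Definition potential X S eta :=
  forall o, oe o \in X -> src o \in S -> consistent eta o.

Lemma consistent_orev eta o : consistent eta o -> consistent eta (orev o).
Proof.
have [eqv|/eqP nev] := eqVneq (src o) (tgt o); first by rewrite orev_loop.
rewrite /consistent (gain_orev _ nev) => h.
by rewrite -[LHS]invgK h invgM invgK.
Qed.

Lemma consistent_oe eta o o' : oe o' = oe o -> consistent eta o -> consistent eta o'.
Proof. by case/oe_eq=> ->; last exact: consistent_orev. Qed.

Lemma walk_gain_cons o w : walk_gain phi (o :: w) = phi o * walk_gain phi w.
Proof. by rewrite /walk_gain big_cons. Qed.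

Lemma walk_gain_cat w1 w2 :
  walk_gain phi (w1 ++ w2) = walk_gain phi w1 * walk_gain phi w2.
Proof. by rewrite /walk_gain big_cat. Qed.

Lemma walk_gain_consistent eta o w : path consecutive o w ->
  (forall o', o' \in o :: w -> consistent eta o') ->
  walk_gain phi (o :: w) = (eta (src o))^-1 * eta (tgt (last o w)).
Proof.
elim: w o => [|o2 w IH] o /=.
  by move=> _ h; rewrite walk_gain_cons /walk_gain big_nil mulg1 h // mem_head.
move=> /andP[/eqP co pw] h; rewrite walk_gain_cons IH //.
  by rewrite h ?mem_head // co mulgA mulgK.
by move=> o' o'w; apply: h; rewrite inE o'w orbT.
Qed.

Lemma closed_walk_gain eta w C : simple_closed_walk w C ->
  (forall o, oe o \in C -> consistent eta o) -> walk_gain phi w = 1.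
Proof.
case=> + + _ _ <-; case: w => // o w _ /=; rewrite rcons_path => /andP[pw /eqP cl] h.
rewrite (walk_gain_consistent (eta := eta) pw) ?cl ?mulVg // => o' o'w.
by apply: h; rewrite inE map_f.
Qed.

Lemma balanced_consistent C : balanced phi C ->
  exists eta, forall o, oe o \in C -> consistent eta o.
Proof.
case=> w [wn0 wc ws we <-] w1.
exists (fun x => walk_gain phi (take (index x (map src w)) w)).
move=> o'; rewrite inE => /mapP[o ow] eqe; apply: (consistent_oe eqe).
rewrite /consistent; case/splitPr: ow wn0 wc ws we w1 => wa wb _.
rewrite map_cat /= => wc ws _ w1.
have idx (s t : seq V) x : uniq (s ++ x :: t) -> index x (s ++ x :: t) = size s.
  rewrite cat_uniq /= negb_or => /and3P[_ /andP[xs _] _].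
  by rewrite index_cat (negPf xs) /= eqxx addn0.
rewrite (idx _ _ _ ws) size_map take_size_cat //.
case: wb wc ws w1 => [|o2 wb] wc ws w1.
  have -> : index (tgt o) (map src wa ++ [:: src o]) = 0.
    case: wa wc {ws w1} => [|o1 wa] /=; rewrite ?cats1 ?rcons_path ?last_rcons.
      by rewrite andbT => /eqP <-; rewrite eqxx.
    by move=> /andP[_ /eqP <-]; rewrite eqxx.
  rewrite take0 /(walk_gain _ [::]) big_nil mulg1; apply/esym/mulg1_eq.
  by rewrite -[RHS]w1 walk_gain_cat walk_gain_cons /walk_gain big_nil mulg1.
have -> : tgt o = src o2.
  by case: wa wc {ws w1} => [|o1 wa] /=; rewrite ?rcons_cat ?cat_path /=;
     [move=> /andP[/eqP]|move=> /and4P[_ _ /eqP]].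
have ws' : uniq ((map src wa ++ [:: src o]) ++ src o2 :: map src wb).
  by rewrite -catA.
have -> : map src wa ++ src o :: map src (o2 :: wb) =
  (map src wa ++ [:: src o]) ++ src o2 :: map src wb by rewrite -catA.
rewrite (idx _ _ _ ws') size_cat size_map /= addn1 -cat_rcons.
rewrite take_size_cat ?size_rcons // -cats1 walk_gain_cat mulKg.
by rewrite walk_gain_cons /walk_gain big_nil mulg1.
Qed.

Lemma potential_sub X Y (S T : {set V}) eta : X \subset Y -> S \subset T ->
  potential Y T eta -> potential X S eta.
Proof.
by move=> /subsetP sXY /subsetP sST h o oX oS; apply: h; rewrite ?sXY ?sST.
Qed.

Lemma potential_U1 X S eta o : potential X S eta -> consistent eta o ->
  potential (oe o |: X) S eta.
Proof.
move=> h ho o'; rewrite !inE => /orP[/eqP eqe _|]; first exact: consistent_oe ho.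
exact: h.
Qed.

(* Left translation of a potential on one class makes any given edge leaving
   that class consistent. *)
Lemma potential_shift X S eta o : potential X S eta ->
  ~~ connect (adj X) (src o) (tgt o) ->
  exists2 eta', potential X S eta' & consistent eta' o.
Proof.
move=> h ncon; pose c := eta (src o) * phi o * (eta (tgt o))^-1.
exists (fun x => if connect (adj X) (tgt o) x then c * eta x else eta x).
  move=> o' o'X o'S; rewrite /consistent h //.
  have := closed_vclass (tgt o) o'X; rewrite !inE => ->.
  by case: ifP => // _; rewrite invgM -mulgA mulKg.
rewrite /consistent connect0 connect_adj_sym (negPf ncon).
by rewrite /c mulgVK mulKg.
Qed.

Definition balanced_on X S :=
  forall C, C \subset X -> verts C \subset S -> is_cycle C -> balanced phi C.

Lemma balanced_on_potential X S : closed_under X S ->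
  balanced_on X S <-> exists eta, potential X S eta.
Proof.
move=> clS; split=> [|[eta h] C /subsetP sCX /subsetP sCS [w hw]]; last first.
  exists w => //; apply: (closed_walk_gain (eta := eta) hw) => o oC.
  by apply: h; rewrite ?sCX // sCS // src_verts.
elim/finset_ind: X clS => [|e X neX IH] clS bal.
  by exists (fun=> 1) => o; rewrite inE.
have [o oE] := oe_surj e; subst e.
have clS' : closed_under X S by move=> o' o'X; apply: clS; rewrite inE o'X orbT.
have [|eta h] := IH clS'.
  by move=> C sCX; apply: bal; rewrite (subset_trans sCX) // subsetUr.
have [oS|oNS] := boolP (src o \in S); last first.
  exists eta => o'; rewrite !inE => /orP[/eqP /oe_eq[]->|]; last exact: h.
    by rewrite (negPf oNS).
  by rewrite [src _]/(tgt o) -clS ?setU11 // (negPf oNS).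
have [con|ncon] := boolP (connect (adj X) (src o) (tgt o)); last first.
  by have [eta' h1 h2] := potential_shift h ncon; exists eta'; apply: potential_U1.
exists eta; apply: potential_U1 => //.
rewrite connect_adj_sym in con; case/connectP: con => p0 /shortenP[p pP pU _] eqs.
have [w [wX ws wt wc wu]] := lift_path pP pU.
have lastw : tgt (last o w) = src o.
  by rewrite -last_map wt -eqs.
have scw : simple_closed_walk (o :: w) (wedges (o :: w)).
  split=> //.
  - by rewrite /= rcons_path wc // /consecutive /= lastw.
  - rewrite map_cons ws; case/lastP: p {pP wt} pU eqs {ws} => [|p x] //.
    by rewrite belast_rcons last_rcons -rcons_cons rcons_uniq => pU ->.
  - rewrite /= wu andbT; apply/mapP => -[o' /(allP wX) o'X eqe].
    by rewrite -eqe (negPf neX) in o'X.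
have sub : forall o', o' \in o :: w -> oe o' \in oe o |: X.
  by move=> o'; rewrite !inE => /predU1P[->|/(allP wX) ->]; rewrite ?eqxx ?orbT.
have inS : forall o', o' \in w -> src o' \in S.
  move=> o' o'w; apply: (closed_under_path clS' pP); last first.
    by apply: mem_belast; rewrite -ws map_f.
  by rewrite -clS // setU11.
have /balanced_consistent[eta' h'] : balanced phi (wedges (o :: w)).
  apply: bal; last by exists (o :: w).
    by apply/subsetP => e; rewrite inE => /mapP[o' /sub h1 ->].
  apply/subsetP => x /bigcupP[e]; rewrite inE => /mapP[o' o'w ->].
  have o'S : src o' \in S by move: o'w; rewrite inE => /predU1P[->|/inS].
  by rewrite ends_oe !inE => /orP[]/eqP -> //; rewrite -clS // sub.
have := closed_walk_gain scw h'; rewrite walk_gain_cons => /mulg1_eq/(canRL invgK).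
rewrite /consistent => ->.
case: w {ws wt wu scw h'} wX wc lastw sub inS => [|o1 w] wX wc lastw sub inS.
  by move: lastw => /= ->; rewrite /walk_gain big_nil invg1 mulVg.
have := wc o erefl; rewrite [path _ _ _]/= => /andP[/eqP co pw].
rewrite (walk_gain_consistent (eta := eta) pw); last first.
  by move=> o' o'w; apply: h; [exact: (allP wX)|exact: inS].
by move: lastw; rewrite [last _ _]/= => ->; rewrite -co invgM invgK.
Qed.
End Potentials.

Section FrameMatroid.
Variables (Gam : groupType) (G : mgraph) (phi : gain Gam G).
Local Notation V := (vertex G).
Implicit Types (X Y C : {set edge G}) (o : oedge G) (S : {set V}).

Definition pot X S : bool := `[< exists eta, potential phi X S eta >].

Definition balanced_classes X : {set {set V}} :=
  [set S in [set vclass X u | u : V] | pot X S].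

Lemma mem_vclass X u : u \in vclass X u.
Proof. by rewrite inE connect0. Qed.

Lemma vclass_eq X u v : v \in vclass X u -> vclass X v = vclass X u.
Proof.
rewrite inE => uv; apply/setP => x; rewrite !inE.
by rewrite (same_connect (@connect_adj_sym G X) uv).
Qed.

Lemma closed_verts X : closed_under X (verts X).
Proof.
move=> o oX; rewrite (src_verts oX); apply/esym.
exact: (@src_verts _ (orev o)).
Qed.

Lemma vclass_closed X S u : closed_under X S -> u \in S -> vclass X u \subset S.
Proof.
move=> clS uS; apply/subsetP => x; rewrite inE => /connectP[p pP ->].
by apply: (closed_under_path clS pP uS); apply: mem_last.
Qed.

Lemma vclass_isolated X u : u \notin verts X -> vclass X u = [set u].
Proof.
move=> uX; apply/eqP; rewrite eqEsubset sub1set mem_vclass andbT.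
apply: vclass_closed; last by rewrite inE.
move=> o oX; rewrite !inE; apply/eqP/eqP => eqo; case/negP: uX; rewrite -eqo.
  exact: src_verts.
exact: (@src_verts _ (orev o)).
Qed.

Lemma frame_rankE X : (frame_rank phi X + #|balanced_classes X| = #|V|)%N.
Proof.
pose A := [set S in balanced_classes X | S \subset verts X].
have bcE : balanced_classes X = A :|: [set [set u] | u in ~: verts X].
  apply/setP => S; rewrite !inE; apply/idP/idP.
    case/andP=> /imsetP[u _ ->] pX; rewrite imset_f //= pX /=.
    have [uX|uX] := boolP (u \in verts X).
      by rewrite vclass_closed //; apply: closed_verts.
    by rewrite vclass_isolated // imset_f ?orbT // inE.
  case/orP => [/andP[]//|/imsetP[u]]; rewrite inE => uX ->.
  rewrite -(vclass_isolated uX) imset_f //=; apply/asboolP; exists (fun=> 1).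
  move=> o oX; rewrite vclass_isolated // inE => /eqP eqo.
  by case/negP: uX; rewrite -eqo src_verts.
have AE : [set B in components X |
      `[< forall C, C \subset X -> verts C \subset B ->
            is_cycle C -> balanced phi C >]] = A.
  have cE u : u \in verts X ->
      [set y in verts X | connect (adj X) u y] = vclass X u.
    move=> uX; apply/setP => y; rewrite !inE andb_idl // => uy.
    by apply: (subsetP (vclass_closed (@closed_verts X) uX)); rewrite inE.
  have bE u : `[< forall C, C \subset X -> verts C \subset vclass X u ->
      is_cycle C -> balanced phi C >] = pot X (vclass X u).
    by apply/asboolP/asboolP => h;
      apply/(balanced_on_potential phi (@closed_vclass G X u)).
  apply/setP => S; rewrite !inE; apply/andP/andP.
    case=> /imsetP[u uX ->]; rewrite cE // bE imset_f // => ->; split=> //.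
    by apply: vclass_closed => //; apply: closed_verts.
  case=> /andP[/imsetP[u _ ->] pX] sX; rewrite bE; split=> //.
  have uX : u \in verts X by apply: (subsetP sX); apply: mem_vclass.
  by rewrite -cE //; apply: imset_f.
rewrite /frame_rank AE bcE cardsU.
have -> : A :&: [set [set u] | u in ~: verts X] = set0.
  apply/setP => S; rewrite !inE; apply/negP => /andP[/andP[_ sS]].
  by case/imsetP=> u; rewrite inE => uX eqS; rewrite eqS sub1set (negPf uX) in sS.
rewrite cards0 subn0 card_imset; last exact: set1_inj.
have leA : #|A| <= #|verts X|.
  apply: leq_trans (leq_imset_card (vclass X) _); apply/subset_leq_card/subsetP.
  move=> S; rewrite !inE => /andP[/andP[/imsetP[u _ ->] _] sX].
  by rewrite imset_f //; apply: (subsetP sX); apply: mem_vclass.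
by rewrite addnA subnK // cardsC.
Qed.

Definition spanned X o : Prop :=
  (~~ pot X (vclass X (src o)) /\ ~~ pot X (vclass X (tgt o))) \/
  (connect (adj X) (src o) (tgt o) /\
   forall eta, potential phi X (vclass X (src o)) eta -> consistent phi eta o).

Lemma pot_sub X Y (S T : {set V}) : X \subset Y -> S \subset T -> pot Y T -> pot X S.
Proof.
by move=> sXY sST /asboolP[eta h]; apply/asboolP; exists eta; apply: potential_sub h.
Qed.

Lemma vclass_sub X Y u : X \subset Y -> vclass X u \subset vclass Y u.
Proof.
by move=> sXY; apply/subsetP => x; rewrite !inE; apply: connect_adj_mono.
Qed.

Lemma spanned_mono X Y o : X \subset Y -> spanned X o -> spanned Y o.
Proof.
move=> sXY [[h1 h2]|[con h]]; [left|right].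
  by split; [apply: contra h1|apply: contra h2];
    apply: pot_sub => //; apply: vclass_sub.
split; first exact: connect_adj_mono con.
by move=> eta heta; apply: h; apply: potential_sub heta => //; apply: vclass_sub.
Qed.

Lemma potential_unique X u eta eta' x : potential phi X (vclass X u) eta ->
  potential phi X (vclass X u) eta' -> x \in vclass X u ->
  (eta u)^-1 * eta x = (eta' u)^-1 * eta' x.
Proof.
move=> h h' xu.
pose S := [set y in vclass X u | (eta u)^-1 * eta y == (eta' u)^-1 * eta' y].
suff /subsetP/(_ x xu) : vclass X u \subset S by rewrite inE => /andP[_ /eqP].
apply: vclass_closed; last by rewrite inE mem_vclass !mulVg eqxx.
have step (e : V -> Gam) o : consistent phi e o -> e (tgt o) = e (src o) * phi o.
  by move=> ->; rewrite mulVKg.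
move=> o oX; rewrite /S [LHS]inE [RHS]inE -(closed_vclass u oX).
case: (boolP (_ \in _)) => //= oS; rewrite !(step _ o) ?mulgA; last 2 first.
- exact: h'.
- exact: h.
by rewrite (inj_eq (@mulIg _ (phi o))).
Qed.

Lemma closed_underU X S T : closed_under X S -> closed_under X T ->
  closed_under X (S :|: T).
Proof. by move=> h1 h2 o oX; rewrite !inE h1 // h2. Qed.

Definition merged X o : {set V} := vclass X (src o) :|: vclass X (tgt o).

Lemma closed_merged X o : closed_under X (merged X o).
Proof. by apply: closed_underU; apply: closed_vclass. Qed.

Lemma vclass_merged X o x : x \in merged X o ->
  vclass X x = vclass X (src o) \/ vclass X x = vclass X (tgt o).
Proof. by rewrite inE => /orP[] /vclass_eq; [left|right]. Qed.

Lemma vclassC X x y : (x \in vclass X y) = (y \in vclass X x).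
Proof. by rewrite !inE connect_adj_sym. Qed.

Lemma vclass_U1_out X o x : x \notin merged X o ->
  vclass (oe o |: X) x = vclass X x.
Proof.
rewrite inE negb_or !(vclassC _ x) => /andP[hs ht].
apply/eqP; rewrite eqEsubset [X in _ && X]vclass_sub ?subsetUr // andbT.
apply: vclass_closed; last exact: mem_vclass.
move=> o'; rewrite !inE => /orP[/eqP/oe_eq[]->|/(closed_vclass x)].
- by move: hs ht; rewrite !inE => /negPf -> /negPf ->.
- by move: hs ht; rewrite !inE => /negPf -> /negPf ->.
- by rewrite !inE.
Qed.

Lemma vclass_U1_in X o x : x \in merged X o ->
  vclass (oe o |: X) x = merged X o.
Proof.
have con : connect (adj (oe o |: X)) (src o) (tgt o).
  by apply/connect1/adjP; exists o; rewrite setU11.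
have sX : X \subset oe o |: X by exact: subsetUr.
have ts : vclass (oe o |: X) (tgt o) = vclass (oe o |: X) (src o).
  by apply: vclass_eq; rewrite inE.
move=> xM; have -> : vclass (oe o |: X) x = vclass (oe o |: X) (src o).
  apply: vclass_eq; move: xM; rewrite inE => /orP[].
    exact: (subsetP (vclass_sub _ sX)).
  by move/(subsetP (vclass_sub _ sX)); rewrite ts.
apply/eqP; rewrite eqEsubset subUset -{3}ts !vclass_sub // !andbT.
apply: vclass_closed; last by rewrite inE mem_vclass.
move=> o'; rewrite in_setU1 => /orP[/eqP/oe_eq[]->|/closed_merged -> //].
  by rewrite !inE !connect0 orbT.
by rewrite !inE !connect0 orbT.
Qed.

Definition outer_classes X o : {set {set V}} :=
  [set S in balanced_classes X | (src o \notin S) && (tgt o \notin S)].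

Lemma pot_U1_out X o S : src o \notin S -> tgt o \notin S ->
  pot (oe o |: X) S = pot X S.
Proof.
move=> sS tS; apply/idP/idP; first by apply: pot_sub; rewrite ?subsetUr.
move=> /asboolP[eta h]; apply/asboolP; exists eta => o'.
rewrite !inE => /orP[/eqP/oe_eq[]->|]; last exact: h.
  by rewrite (negPf sS).
by rewrite [src _]/(tgt o) (negPf tS).
Qed.

Lemma card_pot1 X (T : {set V}) : #|[set S in [set T] | pot X S]| = pot X T.
Proof.
case: (boolP (pot X T)) => h.
  apply/eqP/cards1P; exists T; apply/setP => S; rewrite !inE andb_idr //.
  by move=> /eqP ->.
apply: eq_card0 => S; rewrite !inE; apply/negP => /andP[/eqP ->].
by rewrite (negPf h).
Qed.

Lemma balanced_classes_U1 X o :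
  #|balanced_classes (oe o |: X)| =
  (#|outer_classes X o| + pot (oe o |: X) (merged X o))%N.
Proof.
have -> : balanced_classes (oe o |: X) =
    outer_classes X o :|: [set S in [set merged X o] | pot (oe o |: X) S].
  apply/setP => S; rewrite !inE; apply/idP/idP.
    case/andP=> /imsetP[x _ ->] pS; have [xM|xM] := boolP (x \in merged X o).
      by move: pS; rewrite vclass_U1_in // eqxx => -> /=; rewrite orbT.
    move: pS; rewrite vclass_U1_out //; move: xM; rewrite inE negb_or !(vclassC _ x).
    by move=> /andP[h1 h2]; rewrite pot_U1_out // imset_f // h1 h2 => ->.
  case/orP=> [/andP[/andP[/imsetP[x _ ->] pS] /andP[h1 h2]]|/andP[/eqP-> ->]].
    rewrite pot_U1_out // pS andbT -(@vclass_U1_out X o) ?imset_f //.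
    by rewrite inE negb_or !(vclassC _ x) h1.
  rewrite andbT -(@vclass_U1_in X o (src o)) ?imset_f //.
  by rewrite inE mem_vclass.
rewrite cardsU disjoint_setI0 ?cards0 ?subn0; last first.
  rewrite -setI_eq0; apply/eqP/setP => S; rewrite !inE.
  apply/negP => /andP[/andP[_ /andP[h _]] /andP[/eqP eqS _]]; case/negP: h.
  by rewrite eqS inE mem_vclass.
by rewrite card_pot1.
Qed.

Lemma balanced_classes_outer X o :
  #|balanced_classes X| =
  (#|outer_classes X o| +
   (pot X (vclass X (src o)) +
    (~~ connect (adj X) (src o) (tgt o) && pot X (vclass X (tgt o)))))%N.
Proof.
pose P := [set S in [set vclass X (src o); vclass X (tgt o)] | pot X S].
have -> : balanced_classes X = outer_classes X o :|: P.
  apply/setP => S; rewrite !inE; apply/idP/idP.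
    case/andP=> /imsetP[x _ ->] pS; rewrite imset_f // pS /= andbT.
    have [xM|] := boolP (x \in merged X o); last first.
      by rewrite inE negb_or !(vclassC _ x) => ->.
    by have [->|->] := vclass_merged xM; rewrite eqxx !orbT.
  by case/orP=> [/andP[]//|/andP[/orP[]/eqP -> ->]]; rewrite imset_f.
rewrite cardsU disjoint_setI0 ?cards0 ?subn0; last first.
  rewrite -setI_eq0; apply/eqP/setP => S; rewrite !inE.
  apply/negP => /andP[/andP[_ /andP[h1 h2]] /andP[/orP[]/eqP eqS _]].
    by rewrite eqS mem_vclass in h1.
  by rewrite eqS mem_vclass in h2.
congr (_ + _)%N; rewrite /P.
have -> : connect (adj X) (src o) (tgt o) =
    (vclass X (tgt o) == vclass X (src o)).
  apply/idP/eqP => [h|h]; first by apply: vclass_eq; rewrite inE.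
  by have := mem_vclass X (tgt o); rewrite h inE.
move: (vclass X (src o)) (vclass X (tgt o)) => A B.
rewrite -(card_pot1 X A); have [->|nAB] := eqVneq B A; first by rewrite setUid addn0.
rewrite -(card_pot1 X B) -cardsUI disjoint_setI0 ?cards0 ?addn0.
  by congr #|pred_of_set _|; apply/setP => S; rewrite !inE andb_orl.
rewrite -setI_eq0; apply/eqP/setP => S; rewrite !inE.
apply/negP => /andP[/andP[/eqP-> _] /andP[/eqP h _]].
by rewrite h eqxx in nAB.
Qed.

Lemma balanced_classes_step X o :
  #|balanced_classes X| = (#|balanced_classes (oe o |: X)| + ~~ `[< spanned X o >])%N.
Proof.
rewrite (balanced_classes_outer X o) balanced_classes_U1 -addnA; congr (_ + _)%N.
have sX : X \subset oe o |: X by exact: subsetUr.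
have [con|ncon] := boolP (connect (adj X) (src o) (tgt o)).
  have eqM : merged X o = vclass X (src o).
    by rewrite /merged (@vclass_eq X (src o) (tgt o)) ?inE // setUid.
  rewrite /= addn0 eqM; case: (boolP (pot X _)) => pX; last first.
    have -> : pot (oe o |: X) (vclass X (src o)) = false.
      by apply/negP => h; case/negP: pX; apply: pot_sub h.
    have -> // : `[< spanned X o >].
    by apply/asboolP; left; split=> //; rewrite (@vclass_eq X (src o)) ?inE.
  have [/asboolP[eta h]|pX'] := boolP (pot (oe o |: X) _).
    have ho : consistent phi eta o by apply: h; rewrite ?setU11 ?mem_vclass.
    have -> // : `[< spanned X o >].
    apply/asboolP; right; split=> // eta' h'; rewrite /consistent ho.
    apply: (@potential_unique X) h' _; last by rewrite inE.
    exact: potential_sub h.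
  suff -> : `[< spanned X o >] = false by [].
  apply/asboolP => -[[]|[_ hc]]; first by rewrite pX.
  case/negP: pX'; case/asboolP: pX => eta h; apply/asboolP; exists eta.
  by apply: potential_U1 => //; apply: hc.
have -> : pot (oe o |: X) (merged X o) =
    pot X (vclass X (src o)) && pot X (vclass X (tgt o)).
  apply/idP/andP => [h|[/asboolP[eta1 h1] /asboolP[eta2 h2]]].
    by split; apply: pot_sub h; rewrite ?subsetUl ?subsetUr.
  pose eta x := if x \in vclass X (src o) then eta1 x else eta2 x.
  have h : potential phi X (merged X o) eta.
    move=> o' o'X; rewrite inE /eta /consistent -(closed_vclass (src o) o'X).
    by case: ifP => [o's _|_ /= o't]; [apply: h1|apply: h2].
  have [eta' k1 k2] := potential_shift h ncon.
  by apply/asboolP; exists eta'; apply: potential_U1.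
have -> : `[< spanned X o >] =
    ~~ pot X (vclass X (src o)) && ~~ pot X (vclass X (tgt o)).
  apply/asboolP/andP => [[//|[con]]|]; last by left.
  by rewrite con in ncon.
by case: (pot X _); case: (pot X _).
Qed.

Definition frame_closure X (e : edge G) : bool :=
  `[< exists2 o, oe o = e & spanned X o >].

Lemma frame_rank_step X e :
  e \notin X -> frame_rank phi (e |: X) = (frame_rank phi X + ~~ frame_closure X e)%N.
Proof.
move=> eX; have [o oE] := oe_surj e.
have eqs : frame_closure X e = `[< spanned X o >].
  apply/asboolP/asboolP => [[o' o'E h]|h]; last by exists o.
  apply: contrapT => nh; have := balanced_classes_step X o.
  have := balanced_classes_step X o'; rewrite o'E oE (asboolT h) (asboolF nh).
  by move=> -> /eqP; rewrite addn0 -{1}[X in X == _]addn0 eqn_add2l.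
apply/eqP; rewrite eqs -(eqn_add2r #|balanced_classes (e |: X)|) frame_rankE.
have := balanced_classes_step X o; rewrite oE => st.
by rewrite addnAC -addnA -st frame_rankE.
Qed.

Lemma frame_rank0 : frame_rank phi set0 = 0.
Proof. by rewrite /frame_rank /verts big_set0 cards0. Qed.

Lemma frame_closure_mono X Y e : X \subset Y ->
  frame_closure X e -> frame_closure Y e.
Proof.
move=> sXY /asboolP[o oE h]; apply/asboolP; exists o => //.
exact: spanned_mono h.
Qed.

Definition frame_matroid : matroid (edge G) :=
  Matroid (closure_rank_le_card frame_rank0 frame_rank_step frame_closure_mono)
    (closure_rank_mono frame_rank_step frame_closure_mono)
    (closure_rank_submod frame_rank_step frame_closure_mono).

End FrameMatroid.

(* The class C(Gam, Gam1, AA, G, psi) of circuits of F(G, psi / Gam1). *)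
Definition gain_class (Gam : groupType) (Gam1 : normal_subgroup Gam)
    (AA : set (set Gam)) (G : mgraph) (psi : gain Gam G) : set {set edge G} :=
  fun C => circuit (frame_matroid (quotient_gain psi Gam1)) C /\
    (balanced psi C \/
     ((is_handcuff C \/ is_theta C) /\
      exists (eta : vertex G -> Gam) (A : set Gam),
        AA A /\ (gain_image (switch psi eta) C `<=` A)%classic)).

(* Main.v *)
Require Import Defs.
From mathcomp Require Import boolp classical_sets.
From mathcomp Require Import all_boot.
From mathcomp Require Import zify.

(** Call X good if some switching puts psi(X) inside a subgroup A that meets
    Gam1 trivially and is trivial or belongs to AA.  A circuit is in the class
    iff it is good: for a cycle that is balanced over Gam/Gam1 the gain lies in
    the intersection of A and Gam1, and every other circuit is a handcuff or a
    theta.  Subsets of good sets are good, so it suffices that the union of two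
    circuits C1, C2 of the class with nullity 2 is good (or that C1 and C2 are
    vertex-disjoint, when the union has no other circuit).  Nullity 2 makes
    C1, C2 a modular pair, which bounds the number of balanced components of
    the intersection: with C1 and C2 both unbalanced, every component of the
    intersection is unbalanced, and the partition and malnormality force the
    switchings of C1 and C2 to be compatible; if exactly one of C1, C2 is
    balanced, or their union is, the intersection is connected and one switching
    can be translated to agree with the other; if both are balanced and the
    union is not, there are two components, and A is the member of AA
    containing the discrepancy.

    That a linear class yields an elementary lift reduces to adding one element
    at a time to both sides of the submodular inequality, where it becomes the
    linear class axiom for two fundamental circuits. *)

Set Implicit Arguments.
Unset Strict Implicit.
Unset Printing Implicit Defensive.

(** * Linear classes and elementary lifts *)

Section MatroidTheory.
Variables (E : finType) (N : matroid E).
Implicit Types (X Y Z B C J : {set E}) (e f x : E).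
Local Notation r := (rank N).

Lemma rank_set0 : r set0 = 0.
Proof. by have := rank_le_card N set0; rewrite cards0; case: (r set0). Qed.

Lemma rank_U1 X e : r X <= r (e |: X) <= (r X).+1.
Proof.
have := rank_submod N [set e] X; have := rank_le_card N [set e].
have := rank_mono N (subsetUr [set e] X); rewrite cards1; lia.
Qed.

Lemma rank_setU X Y : r (X :|: Y) <= r X + #|Y :\: X|.
Proof.
have := rank_submod N X (Y :\: X); have := rank_le_card N (Y :\: X).
have -> : X :|: Y :\: X = X :|: Y by apply/setP => x; rewrite !inE; case: (x \in X).
lia.
Qed.

Lemma nullity_mono X Y : X \subset Y -> #|X| + r Y <= #|Y| + r X.
Proof.
move=> sXY; have := rank_setU X Y; rewrite (setUidPr sXY).
by have := cardsD Y X; have := subset_leq_card sXY; rewrite (setIidPr sXY); lia.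
Qed.

(** Submodularity for [e |: X] and [Y], which meet in [X] when [e] lies outside [Y]. *)
Lemma rank_U1_mono X Y e : X \subset Y -> r (e |: X) = r X -> r (e |: Y) = r Y.
Proof.
move=> sXY eqr; have [eY|eY] := boolP (e \in Y).
  by rewrite (setUidPr _) // sub1set.
have := rank_submod N (e |: X) Y; have := rank_U1 Y e.
rewrite -setUA (setUidPr sXY) setIUl (setIidPl sXY).
rewrite disjoint_setI0 ?disjoints1 // set0U; lia.
Qed.

Lemma rank_closure X Y : X \subset Y -> {in Y, forall x, r (x |: X) = r X} -> r Y = r X.
Proof.
move=> sXY h; suff H Z : Z \subset Y -> r (Z :|: X) = r X.
  by have := H _ (subxx Y); rewrite (setUidPl sXY).
elim/finset_ind: Z => [|z Z zZ IH]; first by rewrite set0U.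
rewrite subUset sub1set => /andP[zY sZ].
rewrite -setUA -[RHS](IH sZ); apply: (@rank_U1_mono X); last exact: h.
exact: subsetUr.
Qed.

Lemma independent_sub X Y : X \subset Y -> r Y = #|Y| -> r X = #|X|.
Proof. by move=> /nullity_mono h hY; have := rank_le_card N X; lia. Qed.

Lemma basis_extension J X : J \subset X -> r J = #|J| ->
  exists B, [/\ J \subset B, B \subset X, r B = #|B| & r B = r X].
Proof.
move=> sJX iJ; pose P B := (J \subset B) && (B \subset X) && (r B == #|B|).
have [|B /maxsetP[/andP[/andP[JB BX] /eqP iB] mB] _] := @maxset_exists _ P J.
  by rewrite /P subxx sJX iJ eqxx.
exists B; split=> //; apply/esym/rank_closure => // x xX.
have [xB|xB] := boolP (x \in B); first by rewrite (setUidPr _) // sub1set.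
have /andP[h1 h2] := rank_U1 B x; apply/eqP; rewrite eqn_leq h1 andbT.
rewrite leqNgt; apply/negP => h3; move: (xB); rewrite -(mB (x |: B)) ?setU11 //.
- rewrite /P (subset_trans JB) ?subsetUr // subUset sub1set xX BX /=.
  by have := cardsU1 x B; rewrite xB; have := rank_le_card N (x |: B); lia.
- exact: subsetUr.
Qed.

Lemma circuitP C : circuit N C -> r C < #|C| /\
  (forall X, X \subset C -> r X < #|X| -> X = C).
Proof. by move=> /minsetP[h1 h2]; split=> // X sX h; apply: h2. Qed.

Lemma circuit_exists X : r X < #|X| -> exists2 C, circuit N C & C \subset X.
Proof. by move=> h; have [C cC sC] := @minset_exists _ (dependent N) X h; exists C. Qed.

Lemma circuit_proper_independent C X : circuit N C -> X \proper C -> r X = #|X|.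
Proof.
case/circuitP=> _ h /properP[sX [x xC xX]]; apply/eqP.
rewrite eqn_leq rank_le_card /= leqNgt; apply/negP => /(h _ sX) eqX.
by rewrite eqX xC in xX.
Qed.

Lemma circuit_D1 C e : circuit N C -> e \in C -> r (C :\ e) = #|C :\ e|.
Proof. by move=> cC eC; apply: circuit_proper_independent cC _; apply: properD1. Qed.

Lemma circuit_rank C : circuit N C -> #|C| = (r C).+1.
Proof.
move=> cC; have [h _] := circuitP cC.
have [e eC] : exists e, e \in C by apply/card_gt0P; lia.
have := circuit_D1 cC eC; have := rank_mono N (subD1set C e).
by have := cardsD1 e C; rewrite eC; lia.
Qed.

Lemma circuit_closure C e : circuit N C -> e \in C -> r (e |: (C :\ e)) = r (C :\ e).
Proof.
move=> cC eC; rewrite setD1K // (circuit_D1 cC eC).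
by have := circuit_rank cC; have := cardsD1 e C; rewrite eC; lia.
Qed.

Lemma circuit_neq C1 C2 : circuit N C1 -> circuit N C2 -> C1 != C2 ->
  C1 :&: C2 \proper C1.
Proof.
move=> c1 c2 neq; rewrite properEneq subsetIl andbT.
apply: contra neq => /eqP/setIidPl s12; apply/eqP.
have [_ m2] := circuitP c2; apply: m2 => //.
by have [] := circuitP c1.
Qed.

(** The intersection is properly contained in a circuit, hence independent, and a circuit has rank
    one less than its size; the rest is inclusion-exclusion. *)
Lemma circuit_modular C1 C2 : circuit N C1 -> circuit N C2 -> C1 != C2 ->
  #|C1 :|: C2| = r (C1 :|: C2) + 2 ->
  r (C1 :|: C2) + r (C1 :&: C2) = r C1 + r C2.
Proof.
move=> c1 c2 neq nul; have := circuit_proper_independent c1 (circuit_neq c1 c2 neq).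
have := circuit_rank c1; have := circuit_rank c2.
by have := cardsUI C1 C2; lia.
Qed.

End MatroidTheory.

(** * The rank function of the lift *)

Section ElementaryLift.
Variables (E : finType) (N : matroid E) (CC : set {set E}).
Hypothesis linCC : linear_class N CC.
Implicit Types (X Y Z B C : {set E}) (e f x : E).
Local Notation r := (rank N).

Definition in_class X : bool := `[< forall C, circuit N C -> C \subset X -> CC C >].

Lemma lift_rankE X : lift_rank N CC X = r X + ~~ in_class X.
Proof. by rewrite /lift_rank -/(in_class X); case: ifP; rewrite /= ?addn0 ?addn1. Qed.

Lemma in_class_sub X Y : X \subset Y -> in_class Y -> in_class X.
Proof.
move=> sXY /asboolP h; apply/asboolP => C cC sC; apply: h => //.
exact: subset_trans sXY.
Qed.

(** An element that raises the rank lies in no circuit of [e |: X], so no new circuit appears. *)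
Lemma in_class_coloop X e : in_class X -> r (e |: X) <> r X -> in_class (e |: X).
Proof.
move=> /asboolP gX ne; apply/asboolP => C cC sC.
have [eC|eC] := boolP (e \in C); last first.
  apply: gX => //; apply/subsetP => x xC; move/subsetP/(_ x xC): sC.
  by rewrite !inE => /predU1P[eqx|//]; rewrite -eqx xC in eC.
case: ne; apply: rank_U1_mono (circuit_closure cC eC).
by rewrite subDset.
Qed.

(* The circuit C is generated by the fundamental circuits of e and f with
   respect to a basis of X containing C minus e and f. *)
Lemma in_class_exchange X e f : r (e |: X) = r X -> r (f |: X) = r X ->
  e \notin X -> f \notin X -> e != f ->
  in_class (e |: X) -> in_class (f |: X) -> in_class (e |: (f |: X)).
Proof.
move=> re rf eX fX nef ge gf; apply/asboolP => C cC sC.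
have sub_e g Y : g \notin C -> C \subset g |: Y -> C \subset Y.
  move=> gC /subsetP h; apply/subsetP => x xC; have := h x xC.
  by rewrite !inE => /predU1P[eqx|//]; rewrite -eqx xC in gC.
have [eC|eC] := boolP (e \in C); last first.
  by apply: (asboolW gf) => //; apply: sub_e sC.
have [fC|fC] := boolP (f \in C); last first.
  by apply: (asboolW ge) => //; apply: (@sub_e f); rewrite // setUCA.
have iJ : r (C :\ e :\ f) = #|C :\ e :\ f|.
  apply: circuit_proper_independent cC _.
  by apply: sub_proper_trans (properD1 eC); apply: subD1set.
have sJ : C :\ e :\ f \subset X by rewrite setDDl subDset -setUA.
have [B [JB BX iB rB]] := basis_extension sJ iJ.
(* [B] spans [X], which spans [g], so [g |: B] is dependent; [B] being independent, every circuit in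
   it uses [g]. *)
have fundamental g : g \notin X -> r (g |: X) = r X -> in_class (g |: X) ->
    exists Cg, [/\ circuit N Cg, CC Cg, Cg \subset g |: B & g \in Cg].
  move=> gX rg gg; have gB : g \notin B by apply: contra gX; apply: (subsetP BX).
  have dep : r (g |: B) < #|g |: B|.
    by rewrite cardsU1 gB add1n ltnS -iB rB -rg; apply: rank_mono; apply: setUS.
  have [Cg cg sg] := circuit_exists dep; exists Cg.
  have gC : g \in Cg.
    apply/negPn/negP => gC; have [lt _] := circuitP cg.
    have sB : Cg \subset B.
      apply/subsetP => x xC; move/subsetP/(_ x xC): sg.
      by rewrite !inE => /predU1P[eqx|//]; rewrite -eqx xC in gC.
    by move: lt; rewrite (independent_sub sB iB) ltnn.
  split=> //; apply: (asboolW gg) => //.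
  by apply: subset_trans sg _; apply: setUS.
have [Ce [ce CCe se eCe]] := fundamental e eX re ge.
have [Cf [cf CCf sf fCf]] := fundamental f fX rf gf.
have eB : e \notin B by apply: contra eX; apply: (subsetP BX).
have fB : f \notin B by apply: contra fX; apply: (subsetP BX).
have fCe : f \notin Ce.
  by apply/negP => /(subsetP se); rewrite !inE eq_sym (negPf nef) (negPf fB).
(* [Z] has nullity at most 2 and [Ce :|: Cf], a union of two distinct circuits, at least 2; so the
   union has nullity exactly 2, as the linear class axiom requires. *)
pose Z := e |: (f |: B).
have cardZ : #|Z| = (#|B| + 2).
  by rewrite /Z !cardsU1 !inE (negPf nef) eB fB addnA addnC.
have rZ : #|B| <= r Z.
  by rewrite -iB; apply: rank_mono; rewrite /Z setUA subsetUr.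
have sU : Ce :|: Cf \subset Z.
  rewrite subUset (subset_trans se) 1?(subset_trans sf) ?subsetUr //.
  by rewrite /Z setUCA subsetUr.
have lower : r (Ce :|: Cf) + 2 <= #|Ce :|: Cf|.
  have pr : Ce :&: Cf \proper Cf.
    rewrite properE subsetIr; apply/subsetPn; exists f => //.
    by rewrite inE (negPf fCe).
  have := rank_submod N Ce Cf; have := circuit_rank ce; have := circuit_rank cf.
  by have := circuit_proper_independent cf pr; have := cardsUI Ce Cf; clear; lia.
have upper : #|Ce :|: Cf| = r (Ce :|: Cf) + 2.
  by have := nullity_mono N sU; move: lower cardZ rZ; clear; lia.
have [_ lin] := linCC; apply: (lin _ _ CCe CCf upper) => //.
(* Deleting such an [x] from [Z] keeps the rank, since [C] spans [x]; the rest of [Z] would have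
   nullity at most 1 and still contain the union. *)
apply/subsetP => x xC; apply/negPn/negP => xU.
have sCZ : C \subset Z.
  apply/subsetP => y yC; rewrite !inE; case: eqVneq => //= ye.
  by case: eqVneq => //= yf; apply: (subsetP JB); rewrite !inE ye yf.
have xZ : x \in Z := subsetP sCZ _ xC.
have rx : r Z = r (Z :\ x).
  rewrite -{1}(setD1K xZ); apply: rank_U1_mono (circuit_closure cC xC).
  exact: setSD.
have sUx : Ce :|: Cf \subset Z :\ x by rewrite subsetD1 sU.
have := nullity_mono N sUx; have := cardsD1 x Z; rewrite xZ.
by move: upper cardZ rZ rx; clear; lia.
Qed.

Definition lift_closure X e : bool := lift_rank N CC (e |: X) == lift_rank N CC X.

Lemma lift_rank0 : lift_rank N CC set0 = 0.
Proof.
rewrite lift_rankE rank_set0 (_ : in_class set0) //; apply/asboolP => C cC.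
by rewrite subset0 => /eqP C0; have [] := circuitP cC; rewrite C0 cards0.
Qed.

Lemma lift_rankS X e : e \notin X ->
  lift_rank N CC (e |: X) = lift_rank N CC X + ~~ lift_closure X e.
Proof.
move=> eX; rewrite /lift_closure !lift_rankE.
have := in_class_sub (subsetUr [set e] X); have := @in_class_coloop X e.
have := rank_U1 N X e.
case: (in_class X) => [h1 h2 _|h1 h2 h3]; last first.
  by case: (in_class (e |: X)) h3 => [->//|_]; case: eqVneq; lia.
by case: (in_class (e |: X)) h2 => [_|h]; case: eqVneq => //=; try lia;
  case: (eqVneq (r (e |: X)) (r X)) => [|/eqP/(h isT)] //; lia.
Qed.

(** If the lift spans [e], adding [e] changes neither the rank nor [in_class]. When [f] raises the
    rank it creates no circuit; otherwise [in_class_exchange] applies. *)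
Lemma lift_closure_U1 X e f : lift_closure X e -> lift_closure (f |: X) e.
Proof.
have [eX|eX] := boolP (e \in X).
  by move=> _; rewrite /lift_closure (setUidPr _) // sub1set !inE eX orbT.
have [fX|fX] := boolP (f \in X).
  by rewrite [f |: X](setUidPr _) // sub1set.
have [->|nef] := eqVneq e f; first by rewrite /lift_closure setUA setUid eqxx.
rewrite /lift_closure !lift_rankE => /eqP h.
have [eqe eqg] : r (e |: X) = r X /\ in_class (e |: X) = in_class X.
  have := in_class_sub (subsetUr [set e] X); have := rank_U1 N X e.
  by move: h; case: (in_class X); case: (in_class (e |: X)) => /=; clear; lia.
rewrite (rank_U1_mono (subsetUr [set f] X) eqe) eqn_add2l; apply/eqP; congr (nat_of_bool (~~ _)).
apply/idP/idP; first by apply: in_class_sub; apply: subsetUr.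
move=> gf; have ge : in_class (e |: X).
  by rewrite eqg; apply: in_class_sub gf; apply: subsetUr.
have [eqf|/eqP nf] := eqVneq (r (f |: X)) (r X); first exact: in_class_exchange.
rewrite setUCA; apply: in_class_coloop => //.
by rewrite setUCA (rank_U1_mono (subsetUr [set f] X) eqe) eqe.
Qed.

Lemma lift_closure_mono X Y e : X \subset Y -> lift_closure X e -> lift_closure Y e.
Proof.
move=> sXY; rewrite -(setUidPr sXY) setUC; move: Y {sXY}.
by elim/finset_ind=> [|z Z _ IH] h; rewrite ?set0U // -setUA lift_closure_U1 ?IH.
Qed.

Definition lift_matroid : matroid E :=
  Matroid (closure_rank_le_card lift_rank0 lift_rankS lift_closure_mono)
    (closure_rank_mono lift_rankS lift_closure_mono)
    (closure_rank_submod lift_rankS lift_closure_mono).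

(** * The one-element extension that witnesses the lift *)

Implicit Types S T : {set option E}.

Let someI : injective (@Some E).
Proof. by move=> x y []. Qed.

Let down S : {set E} := Some @^-1: S.

(** The successor accounts for [None], an element of rank 1: contracting it subtracts 1 and leaves
    the rank of [N]. *)
Definition extension_rank S : nat :=
  if None \in S then (r (down S)).+1 else lift_rank N CC (down S).

Let card_down S : #|S| = (None \in S) + #|down S|.
Proof.
rewrite (cardsD1 None S); congr addn; rewrite -(card_imset _ someI).
apply: eq_card => -[x|]; rewrite !inE /=; last by apply/esym/imsetP => -[].
by rewrite mem_imset ?inE //; apply: someI.
Qed.

Lemma extension_rank_le_card S : extension_rank S <= #|S|.
Proof.
rewrite /extension_rank card_down; case: ifP => _ /=.
  by rewrite add1n ltnS rank_le_card.
exact: (rank_le_card lift_matroid).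
Qed.

Lemma extension_rank_mono S T : S \subset T -> extension_rank S <= extension_rank T.
Proof.
move=> sST; have sD : down S \subset down T by apply: preimsetS.
have leN := rank_mono N sD; have leL := rank_mono lift_matroid sD.
rewrite /extension_rank; case: ifP => [SN|SN].
  by rewrite (subsetP sST _ SN).
case: ifP => _; last exact: leL.
by rewrite lift_rankE; case: (in_class _); rewrite /= ?addn0 ?addn1 // ltnW.
Qed.

(** If [None] is in exactly one of the sets, both the intersection and the other set have lift rank;
    when the former gains 1, so does the latter, because [in_class] passes to subsets. *)
Lemma extension_rank_submod S T :
  extension_rank (S :|: T) + extension_rank (S :&: T) <=
  extension_rank S + extension_rank T.
Proof.
have dU : down (S :|: T) = down S :|: down T by apply: preimsetU.
have dI : down (S :&: T) = down S :&: down T by apply: preimsetI.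
have sN := rank_submod N (down S) (down T).
have sL := rank_submod lift_matroid (down S) (down T); rewrite /= in sL.
have gS := in_class_sub (subsetIl (down S) (down T)).
have gT := in_class_sub (subsetIr (down S) (down T)).
rewrite /extension_rank dU dI !inE; case: (None \in S); case: (None \in T) => //=.
- lia.
- rewrite !lift_rankE; case: (in_class (down T)) gT => [->//|_] /=; lia.
- rewrite !lift_rankE; case: (in_class (down S)) gS => [->//|_] /=; lia.
Qed.

Definition extension_matroid : matroid (option E) :=
  Matroid extension_rank_le_card extension_rank_mono extension_rank_submod.

Lemma lift_matroid_elementary : elementary_lift lift_matroid N.
Proof.
exists extension_matroid.
have dE X : down [set Some x | x in X] = X.
  by apply/setP => x; rewrite !inE mem_imset //; apply: someI.
have dN X : down (None |: [set Some x | x in X]) = X.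
  by rewrite -[RHS]dE; apply/setP => x; rewrite !inE.
split=> X /=; rewrite /extension_rank.
  rewrite dE; case: ifP => // /imsetP[x _ //].
have d0 : down [set None] = set0 by apply/setP => x; rewrite !inE.
by rewrite dN d0 !inE eqxx /= rank_set0 subn1.
Qed.

End ElementaryLift.

(** * Walks, cycles, handcuffs and thetas *)

Section Walks.
Variable G : mgraph.
Local Notation V := (vertex G).
Implicit Types (X Y C D : {set edge G}) (o : oedge G) (w : seq (oedge G)) (u v x d : V).

Lemma tgt_verts o C : oe o \in C -> tgt o \in verts C.
Proof. exact: (@src_verts _ (orev o)). Qed.

Lemma vertsP C x : reflect (exists2 o, oe o \in C & src o = x) (x \in verts C).
Proof.
apply: (iffP bigcupP) => [[e eC]|[o oC <-]]; last first.
  by exists (oe o) => //; rewrite ends_oe !inE eqxx.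
have [o eqe] := oe_surj e; subst e; rewrite ends_oe !inE => /orP[]/eqP->.
  by exists o.
by exists (orev o).
Qed.

Lemma vertsS X Y : X \subset Y -> verts X \subset verts Y.
Proof.
by move=> /subsetP sXY; apply/subsetP => x /vertsP[o oX <-]; apply/src_verts/sXY.
Qed.

Lemma vertsU X Y : verts (X :|: Y) = verts X :|: verts Y.
Proof.
apply/setP => x; rewrite inE; apply/vertsP/orP => [[o]|[]/vertsP[o oX <-]].
- by rewrite inE => /orP[oX|oX] <-; [left|right]; apply: src_verts.
- by exists o; rewrite ?inE ?oX.
- by exists o; rewrite ?inE ?oX ?orbT.
Qed.

Lemma is_walk_cat u v w1 w2 : is_walk u v (w1 ++ w2) =
  is_walk u (last u (map tgt w1)) w1 && is_walk (last u (map tgt w1)) v w2.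
Proof. by elim: w1 u => [|o w1 IH] u /=; rewrite ?eqxx // IH andbA. Qed.

Lemma is_walk_rcons u v w o :
  is_walk u v (rcons w o) = is_walk u (src o) w && (tgt o == v).
Proof.
elim: w u => [|o' w IH] u /=; first by rewrite eq_sym.
by rewrite IH andbA.
Qed.

Lemma is_walk_verts u v w : is_walk u v w -> u :: map tgt w = rcons (map src w) v.
Proof.
elim: w u => [|o w IH] u /=; first by move/eqP->.
by case/andP=> /eqP-> /IH ->.
Qed.

Lemma is_walk_rev u v w : is_walk u v w -> is_walk v u (rev (map orev w)).
Proof.
elim: w u => [|o w IH] u /=; first by rewrite eq_sym.
by case/andP=> /eqP <- /IH; rewrite rev_cons is_walk_rcons eqxx andbT.
Qed.

Lemma rev_walk_verts u v w : is_walk u v w ->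
  v :: map tgt (rev (map orev w)) = rev (u :: map tgt w).
Proof.
by move=> /is_walk_verts ->; rewrite rev_rcons map_rev -map_comp.
Qed.

Lemma is_path_rev u v w : is_path u v w -> is_path v u (rev (map orev w)).
Proof.
by case/andP=> hw un; rewrite /is_path is_walk_rev // (rev_walk_verts hw) rev_uniq.
Qed.

Lemma wverts_rev u v w : is_walk u v w -> wverts v (rev (map orev w)) = wverts u w.
Proof.
by move=> hw; apply/setP => x; rewrite !inE -!in_cons (rev_walk_verts hw) mem_rev.
Qed.

Lemma wedges_rev w : wedges (rev (map orev w)) = wedges w.
Proof. by apply/setP => e; rewrite !inE map_rev mem_rev -map_comp. Qed.

Lemma wedges_cat w1 w2 : wedges (w1 ++ w2) = wedges w1 :|: wedges w2.
Proof. by apply/setP => e; rewrite !inE map_cat mem_cat. Qed.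

Lemma wedges_cons o w : wedges (o :: w) = oe o |: wedges w.
Proof. by apply/setP => e; rewrite !inE. Qed.

Lemma wedges_rcons w o : wedges (rcons w o) = wedges w :|: [set oe o].
Proof. by apply/setP => e; rewrite !inE map_rcons mem_rcons inE orbC. Qed.

Lemma wverts_walk u v w : is_walk u v w -> wverts u w = [set x in rcons (map src w) v].
Proof. by move=> hw; apply/setP => x; rewrite !inE -in_cons (is_walk_verts hw). Qed.

Lemma src_wverts u v w o : is_walk u v w -> o \in w -> src o \in wverts u w.
Proof.
by move=> hw ow; rewrite (wverts_walk hw) inE mem_rcons inE map_f ?orbT.
Qed.

Lemma tgt_wverts u w o : o \in w -> tgt o \in wverts u w.
Proof. by move=> ow; rewrite !inE map_f ?orbT. Qed.

Lemma start_wverts u w : u \in wverts u w.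
Proof. by rewrite !inE eqxx. Qed.

Lemma end_wverts u v w : is_walk u v w -> v \in wverts u w.
Proof. by move=> hw; rewrite (wverts_walk hw) inE mem_rcons mem_head. Qed.

Lemma verts_wedges u v w : is_walk u v w -> verts (wedges w) \subset wverts u w.
Proof.
move=> hw; apply/subsetP => x /vertsP[o]; rewrite inE => /mapP[o' ow eqe] <-.
by case: (oe_eq eqe) => ->; [apply: src_wverts hw _|apply: tgt_wverts].
Qed.

Lemma ends_eq o o' : oe o = oe o' -> (src o = src o') \/ (src o = tgt o').
Proof. by case/oe_eq=> ->; [left|right]. Qed.

Lemma path_uniq_edges u v w : is_path u v w -> uniq (map oe w).
Proof.
elim: w u => //= o w IH u /andP[/andP[/eqP su hw] /andP[un uw]].
rewrite (IH (tgt o)) ?andbT; last by apply/andP; split.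
apply/mapP => -[o' o'w /ends_eq]; rewrite su => h; case/negP: un.
have := src_wverts hw o'w; have := tgt_wverts (tgt o) o'w.
by rewrite !inE; case: h => ->.
Qed.

Lemma card_wedges w : uniq (map oe w) -> #|wedges w| = size w.
Proof. by move=> /card_uniqP un; rewrite cardsE un size_map. Qed.

Lemma card_wverts u v w : is_path u v w -> #|wverts u w| = (size w).+1.
Proof. by case/andP=> _ /card_uniqP un; rewrite cardsE un /= size_map. Qed.

Lemma path_consecutive o w o' :
  path consecutive o (rcons w o') = is_walk (tgt o) (src o') w.
Proof.
elim: w o => [|o1 w IH] o /=; first by rewrite andbT.
by rewrite IH eq_sym.
Qed.

(** Trades the cyclic condition for a based walk, which [is_walk_cat] can cut. *)
Lemma simple_closed_walkP w C : simple_closed_walk w C <->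
  exists u, [/\ w != [::], is_walk u u w, uniq (map src w), uniq (map oe w)
    & wedges w = C].
Proof.
case: w => [|o w]; first by split=> [[]|[u []]].
split=> [[h1]|[u [h1]]] /=.
  by rewrite path_consecutive => h2 h3 h4 h5; exists (src o); rewrite eqxx.
by move=> /andP[/eqP <- h2] h3 h4 h5; split; rewrite //= path_consecutive.
Qed.

Lemma closed_walk_verts u w : w != [::] -> is_walk u u w ->
  verts (wedges w) = [set x in map src w].
Proof.
move=> wn0 hw; apply/eqP; rewrite eqEsubset; apply/andP; split; last first.
  by apply/subsetP => x; rewrite inE => /mapP[o ow ->]; apply: src_verts; rewrite inE map_f.
apply: subset_trans (verts_wedges hw) _; rewrite (wverts_walk hw).
apply/subsetP => x; rewrite !inE mem_rcons inE => /predU1P[->|//].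
by case: w wn0 hw => //= o w _ /andP[/eqP-> _]; rewrite mem_head.
Qed.

Lemma card_cycle C : is_cycle C -> #|verts C| = #|C|.
Proof.
case=> w /simple_closed_walkP[u [wn0 hw us ue <-]].
rewrite (closed_walk_verts wn0 hw) card_wedges // cardsE.
by rewrite (card_uniqP us) size_map.
Qed.

(** The last hypothesis prevents a one-edge path from being closed by its own reversal; an empty
    path gives a loop. *)
Lemma path_close u v w o : is_path u v w -> src o = v -> tgt o = u ->
  oe o \notin wedges w ->
  is_cycle (oe o |: wedges w) /\ verts (oe o |: wedges w) = wverts u w.
Proof.
move=> pw ov ou ow; case/andP: (pw) => hw uw.
have cw : is_walk v v (o :: w) by rewrite /= ov ou eqxx.
split; last first.
  rewrite -wedges_cons (closed_walk_verts _ cw) // (wverts_walk hw) -ov.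
  by apply/setP => x; rewrite !inE mem_rcons.
exists (o :: w); apply/simple_closed_walkP; exists v; split=> //.
- by move: uw; rewrite (is_walk_verts hw) rcons_uniq /= ov.
- by rewrite /= (path_uniq_edges pw) andbT; move: ow; rewrite inE.
- exact: wedges_cons.
Qed.

Lemma connect_path X u v : connect (adj X) u v ->
  exists2 w, is_path u v w & wedges w \subset X.
Proof.
case/connectP=> p0 /shortenP[p pP pU _] ->.
suff [w [hw wt wX]] : exists w, [/\ is_walk u (last u p) w, map tgt w = p
    & wedges w \subset X].
  by exists w; rewrite // /is_path hw wt.
elim: p u pP {pU} => [|v' p IH] u /=.
  by exists [::]; rewrite /= eqxx; split=> //; apply/subsetP => e; rewrite inE.
case/andP=> /adjP[o [oX <- <-]] /IH[w [hw wt wX]]; exists (o :: w).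
by rewrite /= eqxx hw wt wedges_cons subUset sub1set oX wX.
Qed.

Lemma cycle_rebase D d : is_cycle D -> d \in verts D -> exists w,
  [/\ w != [::], is_walk d d w, uniq (map src w), uniq (map oe w) & wedges w = D].
Proof.
case=> w [wn0 cw us ue <-] dD.
have : d \in map src w.
  have /simple_closed_walkP[u [_ hw _ _ _]] : simple_closed_walk w (wedges w) by [].
  by move: dD; rewrite (closed_walk_verts wn0 hw) inE.
case/mapP=> o ow ->; case: (rot_to ow) => i w' eqw.
have : simple_closed_walk (o :: w') (wedges w).
  rewrite -eqw; split; rewrite ?rot_cycle ?map_rot ?rot_uniq //.
    by rewrite eqw.
  by apply/setP => e; rewrite !inE map_rot mem_rot.
move=> /simple_closed_walkP[u [h1 /= /andP[/eqP su h2] h3 h4 h5]].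
by exists (o :: w'); split; rewrite //= eqxx su.
Qed.

(** The closed walk based at [d] is cut at the edge leaving [x]; the second part runs from [x] back
    to [d] and is reversed. *)
Lemma cycle_split D d x : is_cycle D -> d \in verts D -> x \in verts D -> d != x ->
  exists w1 w2, [/\ is_path d x w1 /\ is_path d x w2,
    wverts d w1 :&: wverts d w2 = [set d; x],
    [disjoint wedges w1 & wedges w2], wedges w1 :|: wedges w2 = D
    & wverts d w1 \subset verts D /\ wverts d w2 \subset verts D].
Proof.
move=> cD dD xD ndx; have [w [wn0 hw us ue eqD]] := cycle_rebase cD dD.
move: (xD); rewrite -eqD (closed_walk_verts wn0 hw) inE => /mapP[o ow eqx].
case/splitPr: ow wn0 hw us ue eqD => wa wb wn0 hw us ue eqD.
have vD : verts D = [set y in map src (wa ++ o :: wb)].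
  by rewrite -eqD (closed_walk_verts wn0 hw).
move: hw; rewrite is_walk_cat; set y := last _ _ => /andP[ha hb].
have eqy : y = x by move: hb => /= /andP[/eqP <- _].
rewrite {}eqy {y} in ha hb.
move: us ue; rewrite !map_cat !cat_uniq => /and3P[usa dis usb] /and3P[uea dise ueb].
have da : d \in map src wa.
  by case: wa ha {hb vD eqD wn0 usa dis uea dise} => [|o1 wa] /=;
    [rewrite (negPf ndx)|case/andP=> /eqP-> _; rewrite mem_head].
have xb : x \in map src (o :: wb) by rewrite /= eqx mem_head.
have dN z : z \in map src wa -> z \in map src (o :: wb) -> False.
  by move=> za zb; case/hasP: dis; exists z.
have pa : is_path d x wa.
  rewrite /is_path ha (is_walk_verts ha) rcons_uniq usa andbT.
  by apply/negP => /dN; apply.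
have pb : is_path x d (o :: wb).
  rewrite /is_path hb (is_walk_verts hb) rcons_uniq usb andbT.
  by apply/negP => /(dN _ da).
exists wa, (rev (map orev (o :: wb))); split.
- by split=> //; apply: is_path_rev.
- rewrite (wverts_rev hb) (wverts_walk ha) (wverts_walk hb).
  apply/setP => z; rewrite 3!inE !mem_rcons (in_cons x) (in_cons d) in_set2.
  have := @dN z; case: (eqVneq z x) => [->|nzx] /=.
    by move=> _; rewrite xb !orbT.
  case: (eqVneq z d) => [->|nzd] /=; first by rewrite da.
  by move=> h; apply/negP => /andP[/h].
- rewrite wedges_rev -setI_eq0; apply/eqP/setP => e; rewrite 3!inE in_set0.
  apply/negP => /andP[e1 e2]; case/hasP: dise; exists e => //.
- by rewrite wedges_rev -wedges_cat.
- rewrite (wverts_rev hb) (wverts_walk ha) (wverts_walk hb).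
  split; apply/subsetP => z; rewrite 2!inE mem_rcons ?(in_cons x) ?(in_cons d) mem_cat.
    by case/predU1P=> [->|->//]; rewrite xb orbT.
  by case/predU1P=> [->|->]; rewrite ?da ?orbT.
Qed.

(** A path has one vertex more than edges; three paths sharing their two ends lose four in the
    union, which is a net loss of one. *)
Lemma card_theta C : is_theta C -> #|verts C| < #|C|.
Proof.
case=> u [v [w1 [w2 [w3 [nuv [p1 p2 p3] [i12 i13 i23] [d12 d13 d23] ->]]]]].
have uvC : #|[set u; v]| = 2 by rewrite cards2 nuv.
have sub : verts (wedges w1 :|: wedges w2 :|: wedges w3) \subset
    wverts u w1 :|: wverts u w2 :|: wverts u w3.
  rewrite !vertsU; apply: setUSS; [apply: setUSS|].
  - by case/andP: p1 => /verts_wedges.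
  - by case/andP: p2 => /verts_wedges.
  - by case/andP: p3 => /verts_wedges.
have := subset_leq_card sub.
have := cardsUI (wverts u w1 :|: wverts u w2) (wverts u w3).
have := cardsUI (wverts u w1) (wverts u w2).
rewrite setIUl i12 i13 i23 setUid uvC (card_wverts p1) (card_wverts p2) (card_wverts p3).
have := cardsUI (wedges w1 :|: wedges w2) (wedges w3).
have := cardsUI (wedges w1) (wedges w2).
rewrite setIUl !disjoint_setI0 // setU0 cards0.
rewrite (card_wedges (path_uniq_edges p1)) (card_wedges (path_uniq_edges p2)).
by rewrite (card_wedges (path_uniq_edges p3)); clear; lia.
Qed.

Lemma disjoint_verts X Y : [disjoint verts X & verts Y] -> [disjoint X & Y].
Proof.
move=> dis; rewrite -setI_eq0; apply/eqP/setP => e; rewrite !inE.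
apply/negP => /andP[eX eY]; have [o eqe] := oe_surj e; subst e.
move/pred0P/(_ (src o)): dis => /=; by rewrite !src_verts.
Qed.

(** A common edge would have both ends at [x], but a path does not visit a vertex twice. *)
Lemma path_disjoint_edges u v w X x : is_path u v w ->
  verts X :&: wverts u w = [set x] -> [disjoint X & wedges w].
Proof.
move=> pw eqx; rewrite -setI_eq0; apply/eqP/setP => e; rewrite !inE.
apply/negP => /andP[eX /mapP[o ow eqe]]; subst e; case/andP: pw => hw uw.
have /set1P sx : src o \in [set x] by rewrite -eqx inE src_verts // (src_wverts hw ow).
have /set1P tx : tgt o \in [set x] by rewrite -eqx inE tgt_verts // tgt_wverts.
case/splitPr: ow hw uw {eqx} => wa wb + uw.
rewrite is_walk_cat /= => /and3P[_ /eqP lst _].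
move: uw; rewrite map_cat -cat_cons cat_uniq => /and3P[_ /norP[+ _] _].
by rewrite tx -sx lst mem_last.
Qed.

Lemma card_handcuff C : is_handcuff C -> #|verts C| < #|C|.
Proof.
case=> [[C1 [C2 [c1 c2 dis i1 ->]]]|[C1 [C2 [u [v [w [[c1 c2] dis pw [i1 i2] ->]]]]]]].
  rewrite vertsU; have := cardsUI C1 C2; have := cardsUI (verts C1) (verts C2).
  by rewrite i1 disjoint_setI0 // cards0 !card_cycle //; lia.
have d1 := path_disjoint_edges pw i1; have d2 := path_disjoint_edges pw i2.
have d12 := disjoint_verts dis.
have hw : is_walk u v w by case/andP: pw.
have sub : verts (C1 :|: C2 :|: wedges w) \subset verts C1 :|: verts C2 :|: wverts u w.
  by rewrite !vertsU; apply: setUSS => //; apply: verts_wedges hw.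
have := subset_leq_card sub.
have := cardsUI (verts C1 :|: verts C2) (wverts u w).
have := cardsUI (verts C1) (verts C2).
have neq : u != v.
  apply/eqP => uv; have := set11 u; rewrite -{1}i1 {1}uv.
  have := set11 v; rewrite -{1}i2 !inE => /andP[v2 _] /andP[v1 _].
  by move/pred0P/(_ v): dis; rewrite /= v1 v2.
rewrite setIUl i1 i2 (disjoint_setI0 dis) cards0 cards2 neq.
have := cardsUI (C1 :|: C2) (wedges w); have := cardsUI C1 C2.
rewrite setIUl !disjoint_setI0 // setU0 cards0 (card_wverts pw).
by rewrite (card_cycle c1) (card_cycle c2) (card_wedges (path_uniq_edges pw)); clear; lia.
Qed.

(** The shape depends on where [o] ends: at [d] a tight handcuff, at another vertex of [D] a theta,
    and on the path off [D] a loose handcuff whose second cycle is the tail of the path closed by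
    [o]. *)
Lemma lollipop D d w o : is_cycle D -> d \in verts D -> is_path d (src o) w ->
  {in map tgt w, forall x, x \notin verts D} -> oe o \notin D ->
  oe o \notin wedges w -> tgt o \in verts D :|: wverts d w ->
  is_handcuff (D :|: wedges (rcons w o)) \/ is_theta (D :|: wedges (rcons w o)).
Proof.
move=> cD dD pw wD oD ow; case/andP: (pw) => hw uw.
have disj : [disjoint D & wedges w].
  rewrite -setI_eq0; apply/eqP/setP => e; rewrite !inE; apply/negP.
  by case/andP=> eD /mapP[o' o'w eqe]; case/negP: (wD _ (map_f tgt o'w));
     rewrite tgt_verts // -eqe.
have wvD y : y \in verts D -> y \in wverts d w -> y = d.
  by move=> yD; rewrite !inE => /predU1P[//|/wD]; rewrite yD.
have [tD _|tD] := boolP (tgt o \in verts D).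
  have [td|td] := eqVneq (tgt o) d.
    have [c2 v2] := path_close pw erefl td ow.
    left; left; exists D, (oe o |: wedges w); split=> //.
    - rewrite -setI_eq0; apply/eqP/setP => e; rewrite !inE.
      apply/negP => /andP[eD /predU1P[eqe|ew]]; first by rewrite -eqe eD in oD.
      by move/pred0P/(_ e): disj; rewrite /= eD inE ew.
    - rewrite v2 (_ : _ :&: _ = [set d]) ?cards1 //; apply/setP => y.
      rewrite in_setI in_set1; apply/andP/eqP => [[]|->]; first exact: wvD.
      by rewrite dD start_wverts.
    - by rewrite wedges_rcons [_ :|: [set _]]setUC.
  right; rewrite eq_sym in td.
  have [w1 [w2 [[p1 p2] i12 d12 eqD [s1 s2]]]] := cycle_split cD dD tD td.
  have tN : tgt o \notin wverts d w.
    by apply/negP => /(wvD _ tD) eqt; rewrite eqt eqxx in td.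
  have p3 : is_path d (tgt o) (rcons w o).
    apply/andP; split; first by rewrite is_walk_rcons hw eqxx.
    by rewrite map_rcons -rcons_cons rcons_uniq uw andbT; move: tN; rewrite inE.
  have wvr y : (y \in wverts d (rcons w o)) = (y == tgt o) || (y \in wverts d w).
    by rewrite !inE map_rcons mem_rcons inE orbCA.
  have i3 w' : is_path d (tgt o) w' -> wverts d w' \subset verts D ->
      wverts d w' :&: wverts d (rcons w o) = [set d; tgt o].
    move=> /andP[h' _] s'; apply/setP => y; rewrite in_setI wvr !in_set2.
    apply/andP/orP => [[/(subsetP s') yD /predU1P[->|]]|[]/eqP->].
    - by right.
    - by move/(wvD _ yD) ->; left.
    - by rewrite !start_wverts orbT.
    - by rewrite eqxx (end_wverts h').
  have d3 w' : wedges w' \subset D -> [disjoint wedges w' & wedges (rcons w o)].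
    move=> /subsetP s'; rewrite -setI_eq0; apply/eqP/setP => e.
    rewrite wedges_rcons in_setI in_set0 in_setU in_set1; apply/negP.
    move=> /andP[/s' eD /orP[ew|/eqP eqe]]; last by rewrite -eqe eD in oD.
    by move/pred0P/(_ e): disj; rewrite /= eD ew.
  exists d, (tgt o), w1, w2, (rcons w o); split=> //.
  - by split=> //; apply: i3.
  - by split=> //; apply: d3; rewrite -eqD ?subsetUl ?subsetUr.
  - by rewrite eqD.
rewrite inE (negPf tD) /= => tw; left; right.
have : tgt o \in map tgt w.
  by move: tw; rewrite !inE => /predU1P[eqt|//]; rewrite eqt dD in tD.
case/mapP=> o' o'w eqt.
case/splitPr: o'w pw wD ow hw uw disj wvD {tw} => wa wb.
rewrite -cat_rcons; set w1 := rcons wa o' => pw wD ow hw uw disj wvD.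
have lst : last d (map tgt w1) = tgt o by rewrite eqt /w1 map_rcons last_rcons.
move: hw; rewrite is_walk_cat lst => /andP[h1 h2].
move: uw; rewrite map_cat -cat_cons cat_uniq => /and3P[u1 u12 u2].
have t1 : tgt o \in d :: map tgt w1 by rewrite -lst mem_last.
have p1 : is_path d (tgt o) w1 by rewrite /is_path h1.
have p2 : is_path (tgt o) (src o) wb.
  rewrite /is_path h2 /= u2 andbT; apply/negP => tb; case/hasP: u12.
  by exists (tgt o).
have ow2 : oe o \notin wedges wb.
  by apply: contra ow; rewrite wedges_cat in_setU => ->; rewrite orbT.
have [c2 v2] := path_close p2 erefl erefl ow2.
exists D, (oe o |: wedges wb), d, (tgt o), w1; split=> //.
- rewrite v2 -setI_eq0; apply/eqP/setP => y; rewrite in_setI in_set0 inE.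
  apply/negP => /andP[yD]; rewrite inE => /predU1P[eqy|yb].
    by rewrite eqy (negPf tD) in yD.
  by have := wD y; rewrite yD map_cat mem_cat yb orbT => /(_ isT).
- split; apply/setP => y; rewrite in_setI in_set1.
    apply/andP/eqP => [[yD yw]|->]; last by rewrite start_wverts.
    apply: wvD => //; move: yw; rewrite !inE map_cat mem_cat.
    by case/orP=> ->; rewrite ?orbT.
  rewrite v2; apply/andP/eqP => [[]|->]; last by rewrite start_wverts (end_wverts h1).
  rewrite inE in_cons => /predU1P[//|yb]; rewrite inE => y1.
  by case/hasP: u12; exists y.
- rewrite wedges_rcons wedges_cat; apply/setP => e; rewrite !in_setU !in_set1.
  by case: (e \in D); case: (e == _); case: (e \in wedges w1); case: (e \in wedges wb).
Qed.

End Walks.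

(** * Circuits of frame matroids *)

Section FrameCircuits.
Variables (Gam : groupType) (G : mgraph) (phi : gain Gam G).
Local Notation V := (vertex G).
Local Notation N := (frame_matroid phi).
Implicit Types (X Y C D : {set edge G}) (o : oedge G) (S T W : {set V}) (u v x d : V).

Lemma spannedP X o : oe o \notin X ->
  spanned phi X o <-> rank N (oe o |: X) = rank N X.
Proof.
move=> oX; have h1 : (rank N (oe o |: X) + _ = _)%N := frame_rankE phi (oe o |: X).
have h2 : (rank N X + _ = _)%N := frame_rankE phi X.
have := balanced_classes_step phi X o; case: asboolP => sp h3; split=> // h.
  by move: h1 h2 h3; clear; lia.
by move: h1 h2 h3; rewrite h; clear; lia.
Qed.

Lemma circuit_spanned C o : circuit N C -> oe o \in C -> spanned phi (C :\ oe o) o.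
Proof. by move=> cC oC; apply/spannedP; [rewrite !inE eqxx|apply: circuit_closure]. Qed.

Lemma spanned_dependent X o : oe o \in X -> spanned phi (X :\ oe o) o ->
  rank N X < #|X|.
Proof.
move=> oX /spannedP; rewrite setD1K // !inE eqxx => /(_ isT) ->.
by rewrite (cardsD1 (oe o) X) oX add1n ltnS rank_le_card.
Qed.

(** * Restriction of an edge set to a closed set of vertices *)

Section Restriction.
Variables (X Y : {set edge G}) (S : {set V}).
Hypotheses (sYX : Y \subset X) (clS : closed_under X S).
Hypothesis resY : forall o, oe o \in X -> src o \in S -> oe o \in Y.

Lemma vclass_restrict u : u \in S -> vclass Y u = vclass X u.
Proof.
move=> uS; apply/eqP; rewrite eqEsubset vclass_sub //=.
apply: vclass_closed; last exact: mem_vclass.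
have sS : vclass Y u \subset S.
  apply: vclass_closed => // o oY; apply: clS; exact: (subsetP sYX).
move=> o oX; apply/idP/idP => h.
  by rewrite -(@closed_vclass _ Y u o) // resY // (subsetP sS).
by rewrite (@closed_vclass _ Y u o) // resY // clS // (subsetP sS).
Qed.

Lemma potential_restrict T eta : T \subset S ->
  potential phi Y T eta <-> potential phi X T eta.
Proof.
move=> /subsetP sT; split=> h o oX oT; apply: h => //.
  by apply: resY => //; apply: sT.
exact: (subsetP sYX).
Qed.

Lemma pot_restrict T : T \subset S -> pot phi Y T = pot phi X T.
Proof.
by move=> sT; apply/asboolP/asboolP => -[eta /potential_restrict h]; exists eta; apply: h.
Qed.

(** [Y] holds every edge of [X] at [S], and reachability and potentials on [S] see only those
    edges. *)
Lemma spanned_restrict o : src o \in S -> tgt o \in S ->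
  spanned phi X o -> spanned phi Y o.
Proof.
move=> sS tS; have sub u : u \in S -> vclass X u \subset S.
  by move=> uS; apply: vclass_closed.
rewrite /spanned !vclass_restrict // !pot_restrict ?sub //.
case=> [|[con h]]; [by left|right; split].
  by move: con; have := vclass_restrict sS => /setP/(_ (tgt o)); rewrite !inE => ->.
by move=> eta /potential_restrict; rewrite sub // => /(_ isT)/h.
Qed.

End Restriction.

Lemma circuit_nonempty C : circuit N C -> exists o, oe o \in C.
Proof.
move=> /circuitP[h _]; have /card_gt0P[e eC] : 0 < #|C| by apply: leq_ltn_trans h.
by have [o eqe] := oe_surj e; exists o; rewrite eqe.
Qed.

(** The edges [Y] of [C] in the component of [o] already span [o] without [o] itself, so [Y] is
    dependent and minimality gives [Y = C]. *)
Lemma circuit_connected C u : circuit N C -> u \in verts C -> vclass C u = verts C.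
Proof.
move=> cC uC; apply/eqP; rewrite eqEsubset vclass_closed //=; last exact: closed_verts.
have /vertsP[o oC ou] := uC; subst u.
have clS : closed_under C (vclass C (src o)) by apply: closed_vclass.
pose Y := [set e in C | ends e \subset vclass C (src o)].
have inY o' : oe o' \in C -> src o' \in vclass C (src o) -> oe o' \in Y.
  move=> o'C o's; rewrite inE o'C ends_oe; apply/subsetP => x /set2P[]-> //.
  by rewrite -clS.
have oY : oe o \in Y by rewrite inY ?mem_vclass.
suff eqY : Y = C.
  apply/subsetP => x /vertsP[o' o'C <-]; move: o'C; rewrite -{1}eqY inE => /andP[_].
  by move/subsetP; apply; rewrite ends_oe !inE eqxx.
have [_ mC] := circuitP cC; apply: mC; first by apply/subsetP => e; rewrite inE => /andP[].
apply: (spanned_dependent oY).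
apply: (@spanned_restrict (C :\ oe o) _ (vclass C (src o))).
- by apply: setSD; apply/subsetP => e; rewrite inE => /andP[].
- by move=> o'; rewrite inE => /andP[_]; apply: clS.
- by move=> o'; rewrite !in_setD1 => /andP[-> o'C] o's; rewrite inY.
- exact: mem_vclass.
- by rewrite -clS ?mem_vclass.
- exact: circuit_spanned.
Qed.

(** Vertices of [W] on no edge of [Y] count as balanced singletons. *)
Definition balanced_classes_in W Y : {set {set V}} :=
  [set S in balanced_classes phi Y | S \subset W].

Lemma card_balanced_classes Y W : verts Y \subset W ->
  #|balanced_classes phi Y| = (#|~: W| + #|balanced_classes_in W Y|)%N.
Proof.
move=> /subsetP sYW.
have iso u : u \notin W -> vclass Y u = [set u].
  by move=> uW; apply: vclass_isolated; apply: contra uW; apply: sYW.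
have clW : closed_under Y W.
  by move=> o oY; rewrite !sYW ?src_verts ?tgt_verts.
have -> : balanced_classes phi Y = [set [set u] | u in ~: W] :|: balanced_classes_in W Y.
  apply/setP => S; rewrite in_setU in_set; apply/idP/orP.
    case/andP=> /imsetP[u _ ->] pS; have [uW|uW] := boolP (u \in W).
      by right; rewrite !in_set imset_f // pS vclass_closed.
    by left; rewrite iso // imset_f // inE.
  case=> [/imsetP[u]|]; last by rewrite !in_set => /andP[].
  rewrite inE => uW ->; rewrite -(iso _ uW) imset_f //=; apply/asboolP.
  exists (fun=> 1%g) => o oY; rewrite iso // inE => /eqP eqo.
  by case/negP: uW; rewrite -eqo sYW // src_verts.
rewrite cardsU disjoint_setI0 ?cards0 ?subn0.
  by rewrite card_imset //; apply: set1_inj.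
rewrite -setI_eq0; apply/eqP/setP => S; rewrite in_setI in_set0; apply/negP.
case/andP=> /imsetP[u]; rewrite inE => uW ->; rewrite inE sub1set.
by rewrite (negPf uW) andbF.
Qed.

Lemma card_balanced_classes_in_vclass Y u :
  #|balanced_classes_in (vclass Y u) Y| = pot phi Y (vclass Y u).
Proof.
rewrite -card_pot1; apply: eq_card => S; rewrite !in_set in_set1.
apply/andP/andP => [[/andP[/imsetP[x _ ->] pS] sS]|[/eqP-> ->]]; last first.
  by rewrite imset_f.
by split=> //; apply/eqP/vclass_eq; apply: (subsetP sS); apply: mem_vclass.
Qed.

Lemma frame_rank_connected Y u : verts Y = vclass Y u ->
  (rank N Y + pot phi Y (verts Y) = #|verts Y|)%N.
Proof.
move=> eqY; have h : (rank N Y + _ = _)%N := frame_rankE phi Y.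
have := card_balanced_classes (subxx (verts Y)).
have := card_balanced_classes_in_vclass Y u; rewrite -eqY => ->.
have := cardsC (verts Y); move: h; clear; lia.
Qed.

(** Balanced circuits thus have as many edges as vertices and unbalanced ones one more, so counting
    separates cycles balanced over the quotient from handcuffs and thetas. *)
Lemma card_circuit C : circuit N C -> (#|C| + pot phi C (verts C) = #|verts C|.+1)%N.
Proof.
move=> cC; have [o oC] := circuit_nonempty cC.
have := frame_rank_connected (esym (circuit_connected cC (src_verts oC))).
by rewrite (circuit_rank cC); clear; lia.
Qed.

Lemma frame_rank_le_verts Y : rank N Y <= #|verts Y|.
Proof. exact: leq_subr. Qed.

(** Otherwise, without [o], the vertex [tgt o] would be isolated, hence balanced and unreachable
    from [src o], and [o] would not be spanned. *)
Lemma circuit_no_pendant C o : circuit N C -> oe o \in C -> src o != tgt o ->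
  exists o', [/\ oe o' \in C, oe o' != oe o & src o' = tgt o].
Proof.
move=> cC oC st; apply: contrapT => no.
have iso : tgt o \notin verts (C :\ oe o).
  apply/negP => /vertsP[o']; rewrite !inE => /andP[ne o'C] eqt.
  by apply: no; exists o'.
case: (circuit_spanned cC oC) => [[_]|[con _]].
  case/negP; apply/asboolP; exists (fun=> 1%g) => o' o'C.
  rewrite vclass_isolated // inE => /eqP eqt.
  by case/negP: iso; rewrite -eqt src_verts.
have : src o \in vclass (C :\ oe o) (tgt o) by rewrite inE connect_adj_sym.
by rewrite vclass_isolated // inE (negPf st).
Qed.

(** An edge is spanned either because a class has no potential, which needs a cycle, or through a
    path that the edge closes. *)
Lemma circuit_has_cycle C : circuit N C -> exists2 D, is_cycle D & D \subset C.
Proof.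
move=> cC; have [o oC] := circuit_nonempty cC.
have oN : oe o \notin C :\ oe o by rewrite !inE eqxx.
case: (circuit_spanned cC oC) => [[np _]|[con _]].
  apply: contrapT => no; case/negP: np; apply/asboolP.
  apply/(balanced_on_potential phi (@closed_vclass G (C :\ oe o) (src o))).
  move=> D sD _ cD; case: no; exists D => //.
  by apply: subset_trans sD _; apply: subD1set.
rewrite connect_adj_sym in con; have [w pw sw] := connect_path con.
have oW : oe o \notin wedges w by apply: contra oN; apply: (subsetP sw).
have [cD _] := path_close pw erefl erefl oW; exists (oe o |: wedges w) => //.
by rewrite subUset sub1set oC (subset_trans sw) // subD1set.
Qed.

(* The pendant path is prolonged until it runs back into the cycle or into
   itself; no vertex of a circuit being pendant, it cannot stop before. *)
Lemma circuit_lollipop C D d w o : circuit N C -> is_cycle D -> D \subset C ->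
  d \in verts D -> is_path d (src o) w ->
  {in map tgt w, forall x, x \notin verts D} -> wedges w \subset C ->
  oe o \in C -> oe o \notin D -> oe o \notin wedges w ->
  is_handcuff C \/ is_theta C.
Proof.
(* A path has fewer edges than [G] has vertices, so the measure drops with each added edge. *)
move=> cC cD sD dD; have [n] := ubnP (#|V| - size w).
elim: n w o => // n IH w o ltn pw wD sw oC oD ow.
have [tL|] := boolP (tgt o \in verts D :|: wverts d w).
  have shape := lollipop cD dD pw wD oD ow tL.
  (* A handcuff or theta has more edges than vertices, so it is dependent and by minimality is all
     of [C]. *)
  have [_ mC] := circuitP cC; rewrite -(mC (D :|: wedges (rcons w o))) //.
    by rewrite wedges_rcons !subUset sD sw sub1set.
  apply: leq_ltn_trans (frame_rank_le_verts _) _.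
  by case: shape => [/card_handcuff|/card_theta].
rewrite inE negb_or => /andP[tD tw]; case/andP: (pw) => hw uw.
have st : src o != tgt o by apply: contra tw => /eqP <-; apply: end_wverts hw.
have [o' [o'C neo o's]] := circuit_no_pendant cC oC st.
have lt : size w < #|V| by rewrite -(card_wverts pw) max_card.
apply: (IH (rcons w o) o') => //.
- by move: ltn lt; rewrite size_rcons; clear; lia.
- apply/andP; split; first by rewrite is_walk_rcons hw o's eqxx.
  by rewrite map_rcons -rcons_cons rcons_uniq uw andbT; move: tw; rewrite inE.
- by move=> x; rewrite map_rcons mem_rcons in_cons => /predU1P[->|/wD].
- by rewrite wedges_rcons subUset sw sub1set.
- by apply: contra tD => o'D; rewrite -o's src_verts.
- rewrite wedges_rcons in_setU in_set1 (negPf neo) orbF.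
  apply: contra tw => o'w; rewrite -o's; apply: (subsetP (verts_wedges hw)).
  exact: src_verts.
Qed.

Lemma circuit_shape C : circuit N C -> is_cycle C \/ (is_handcuff C \/ is_theta C).
Proof.
move=> cC; have [D cD sD] := circuit_has_cycle cC.
have [<-|neD] := eqVneq D C; [by left|right].
have prD : D \proper C by rewrite properEneq neD.
have [d dD] : exists d, d \in verts D.
  by case: cD => -[|o w] [] // _ _ _ _ <-; exists (src o); rewrite src_verts // !inE eqxx.
(* If no edge left [D], then [verts D] would be closed under [C], and connectedness would put all of
   [C] at [D]. *)
have [o [oC oD os]] : exists o, [/\ oe o \in C, oe o \notin D & src o \in verts D].
  have [_ [e eC eD]] := properP prD; have [o eqe] := oe_surj e; subst e.
  apply: contrapT => no; apply: (no); exists o; split=> //.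
  have dC : d \in verts C by apply: (subsetP (vertsS sD)).
  have : src o \in vclass C d by rewrite circuit_connected // src_verts.
  apply: (subsetP (vclass_closed _ dD)) => o' o'C.
  have [o'D|o'D] := boolP (oe o' \in D); first by rewrite src_verts ?tgt_verts.
  apply/idP/idP => h; case: no; first by exists o'.
  by exists (orev o').
apply: (@circuit_lollipop C D (src o) [::] o) => //.
- by rewrite /is_path /= eqxx.
- by apply/subsetP => e; rewrite inE.
- by rewrite inE.
Qed.

End FrameCircuits.

(** * Switching into a subgroup *)

Section GainClass.
Local Open Scope group_scope.
Variables (Gam : groupType) (Gam1 : normal_subgroup Gam) (G : mgraph) (psi : gain Gam G).
Local Notation V := (vertex G).
Local Notation phi := (quotient_gain psi Gam1).
Local Notation N := (frame_matroid phi).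
Implicit Types (A B : set Gam) (eta : V -> Gam) (X Y C D : {set edge G}) (o : oedge G).

(* psi^eta(X) is contained in A. *)
Definition switched_in A eta X : Prop :=
  forall o, oe o \in X -> A ((eta (src o))^-1 * psi o * eta (tgt o)).

Definition trivial_subgroup : set Gam := [set 1]%classic.

Lemma trivial_subgroupP : is_subgroup trivial_subgroup.
Proof.
rewrite /trivial_subgroup; split=> //= [x y -> ->|x ->]; first by rewrite mulg1.
by rewrite invg1.
Qed.

Lemma trivial_sub A : is_subgroup A -> forall g, trivial_subgroup g -> A g.
Proof. by case=> A1 _ _ g ->. Qed.

Lemma conj_setE A c g : conj_set A c g <-> A (g ^ c^-1).
Proof.
split=> [[a Aa <-]|Ag]; first by rewrite conjgK.
by exists (g ^ c^-1) => //; rewrite conjgKV.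
Qed.

Lemma conj_trivial c : conj_set trivial_subgroup c = trivial_subgroup.
Proof.
apply/seteqP; split=> g; rewrite conj_setE /trivial_subgroup /= => h.
  by apply: (conjg_inj c^-1); rewrite h conj1g.
by rewrite h conj1g.
Qed.

Lemma conj_subgroup A c : is_subgroup A -> is_subgroup (conj_set A c).
Proof.
case=> A1 AM AV; split=> [|x y|x]; rewrite !conj_setE.
- by rewrite conj1g.
- by rewrite conjMg; apply: AM.
- by rewrite conjVg; apply: AV.
Qed.

Lemma switched_in_le A B eta X : (forall g, A g -> B g) ->
  switched_in A eta X -> switched_in B eta X.
Proof. by move=> sAB h o oX; apply/sAB/h. Qed.

Lemma switched_in_sub A eta X Y : X \subset Y -> switched_in A eta Y -> switched_in A eta X.
Proof. by move=> /subsetP sXY h o oX; apply/h/sXY. Qed.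

Lemma switched_in_shift A eta X c : switched_in A eta X ->
  switched_in (conj_set A c) (fun x => eta x * c) X.
Proof.
move=> h o /h; rewrite conj_setE.
by rewrite /conjg invgK invgM !mulgA mulgV mul1g mulgK.
Qed.

Lemma quotient_map1 : quotient_map Gam1 1 = 1.
Proof. by apply: (mulgI (quotient_map Gam1 1)); rewrite -quotient_mapM !mulg1. Qed.

Lemma quotient_map_ker g : normal_set Gam1 g <-> quotient_map Gam1 g = 1.
Proof.
rewrite -quotient_map1; split=> [h|/esym/quotient_mapP]; last by rewrite invg1 mul1g.
by apply/esym/quotient_mapP; rewrite invg1 mul1g.
Qed.

(** Modulo [Gam1] the switched gains vanish; switching and [consistent] use opposite conventions,
    hence the inverse of [eta]. *)
Lemma switched_in_potential eta X S : switched_in Gam1 eta X -> pot phi X S.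
Proof.
move=> h; apply/asboolP; exists (fun x => (quotient_map Gam1 (eta x))^-1) => o /h + _.
rewrite quotient_map_ker !quotient_mapM quotient_mapV /consistent /= invgK.
by move/(canRL (mulgK _)); rewrite mul1g => /(canRL (mulVKg _)).
Qed.

Lemma balanced_switched C : balanced psi C ->
  exists eta, switched_in trivial_subgroup eta C.
Proof.
case/balanced_consistent=> eta h; exists (fun x => (eta x)^-1) => o /h ->.
by rewrite /trivial_subgroup /= invgK mulVKg mulgV.
Qed.

Lemma walk_gain_quotient w : walk_gain phi w = quotient_map Gam1 (walk_gain psi w).
Proof.
elim: w => [|o w IH]; first by rewrite /walk_gain !big_nil quotient_map1.
by rewrite !walk_gain_cons IH quotient_mapM.
Qed.

Lemma switched_in_walk A eta X u v w : is_subgroup A -> switched_in A eta X ->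
  is_walk u v w -> wedges w \subset X -> A ((eta u)^-1 * walk_gain psi w * eta v).
Proof.
case=> A1 AM AV h; elim: w u => [|o w IH] u /=.
  by move=> /eqP-> _; rewrite /walk_gain big_nil mulg1 mulVg.
case/andP=> /eqP <- /IH {}IH; rewrite wedges_cons subUset sub1set => /andP[oX wX].
have := AM _ _ (h o oX) (IH wX).
by rewrite walk_gain_cons !mulgA mulgK.
Qed.

(** Taking [eta1] on [verts X1] and [eta2] elsewhere changes [eta2] on [verts X2] only by factors
    from [A]. *)
Lemma switched_in_glue A eta1 eta2 X1 X2 : is_subgroup A ->
  switched_in A eta1 X1 -> switched_in A eta2 X2 ->
  (forall x, x \in verts X1 -> x \in verts X2 -> A ((eta1 x)^-1 * eta2 x)) ->
  exists eta, switched_in A eta (X1 :|: X2).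
Proof.
case=> A1 AM AV h1 h2 h12.
pose eta x := if x \in verts X1 then eta1 x else eta2 x.
have e2 x : x \in verts X2 -> A ((eta x)^-1 * eta2 x).
  by move=> xX2; rewrite /eta; case: ifP => xX1; [apply: h12|rewrite mulVg].
exists eta => o; rewrite inE => /orP[oX|oX].
  by rewrite /eta src_verts // tgt_verts //; apply: h1.
have := AM _ _ (e2 _ (src_verts oX)) (AM _ _ (h2 o oX) (AV _ (e2 _ (tgt_verts oX)))).
by rewrite invgM invgK !mulgA !mulgK.
Qed.

(** Both switchings send each edge into [A], so membership of their discrepancy in [A] passes from
    one end to the other. *)
Lemma switched_in_connected A eta1 eta2 X u x : is_subgroup A ->
  switched_in A eta1 X -> switched_in A eta2 X -> A ((eta1 u)^-1 * eta2 u) ->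
  x \in vclass X u -> A ((eta1 x)^-1 * eta2 x).
Proof.
case=> A1 AM AV h1 h2 Au xu.
pose S := [set y | `[< A ((eta1 y)^-1 * eta2 y) >]].
suff /subsetP/(_ x xu) : vclass X u \subset S by rewrite inE => /asboolP.
apply: vclass_closed; last by rewrite inE; apply/asboolP.
move=> o oX; rewrite !inE; apply/asboolP/asboolP => h.
  have := AM _ _ (AV _ (h1 o oX)) (AM _ _ h (h2 o oX)).
  by rewrite !invgM invgK !mulgA !mulgK mulgVK.
have := AM _ _ (h1 o oX) (AM _ _ h (AV _ (h2 o oX))).
by rewrite !invgM invgK !mulgA !mulgK.
Qed.

(* The values h for which both h^-1 eta1 y is in A and h^-1 eta2 y is in B
   propagate along the edges of X, so they exist on the whole class of x; any
   choice of them switches the gains into the intersection of A and B. *)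
Lemma switched_in_meet A B eta1 eta2 X x : is_subgroup A -> is_subgroup B ->
  switched_in A eta1 X -> switched_in B eta2 X -> eta1 x = eta2 x ->
  (forall g, A g -> B g -> normal_set Gam1 g) -> pot phi X (vclass X x).
Proof.
move=> [A1 AM AV] [B1 BM BV] h1 h2 eqx sAB.
pose P y h := A (h^-1 * eta1 y) /\ B (h^-1 * eta2 y).
pose S := [set y | `[< exists h, P y h >]].
have sS : vclass X x \subset S.
  apply: vclass_closed; last first.
    by rewrite inE; apply/asboolP; exists (eta1 x); split; rewrite ?eqx mulVg.
  move=> o oX; rewrite !inE; apply/asboolP/asboolP => -[h [hA hB]].
    exists ((psi o)^-1 * h); split.
      by have := AM _ _ hA (h1 o oX); rewrite invgM invgK !mulgA mulgK.
    by have := BM _ _ hB (h2 o oX); rewrite invgM invgK !mulgA mulgK.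
  exists (psi o * h); split.
    by have := AM _ _ hA (AV _ (h1 o oX)); rewrite !invgM invgK !mulgA mulgK.
  by have := BM _ _ hB (BV _ (h2 o oX)); rewrite !invgM invgK !mulgA mulgK.
have [eta hP] : {eta : V -> Gam & forall y, y \in vclass X x -> P y (eta y)}.
  apply: (@boolp.choice _ _ (fun y h => y \in vclass X x -> P y h)) => y.
  (* Off the class of [x] the value 1 is a mere default. *)
  have [/(subsetP sS)|_] := boolP (y \in vclass X x); last by exists 1.
  by rewrite inE => /asboolP[h hy]; exists h.
pose Y := [set e in X | ends e \subset vclass X x].
have sw : switched_in Gam1 eta Y.
  move=> o; rewrite inE ends_oe => /andP[oX /subsetP sub].
  have [sA sB] := hP _ (sub _ (set21 _ _)); have [tA tB] := hP _ (sub _ (set22 _ _)).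
  apply: sAB.
    have := AM _ _ sA (AM _ _ (h1 o oX) (AV _ tA)).
    by rewrite invgM invgK !mulgA !mulgK.
  have := BM _ _ sB (BM _ _ (h2 o oX) (BV _ tB)).
  by rewrite invgM invgK !mulgA !mulgK.
have := switched_in_potential (vclass X x) sw.
rewrite (@pot_restrict _ _ phi X Y (vclass X x)) //.
  by apply/subsetP => e; rewrite inE => /andP[].
move=> o oX os; rewrite inE oX ends_oe; apply/subsetP => y /set2P[]-> //.
by rewrite -closed_vclass.
Qed.

(** * Transversal subgroups and the class of circuits *)

Variable AA : set (set Gam).
Hypothesis AA_subgroup : forall A, AA A -> is_subgroup A.
Hypothesis AA_partition : group_partition ([set normal_set Gam1] `|` AA)%classic.
Hypothesis AA_malnormal : forall A, AA A -> malnormal A.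
Hypothesis AA_conj : forall A g, AA A -> AA (conj_set A g).

Local Notation CC := (gain_class Gam1 AA psi).

Definition transversal_subgroup A : Prop :=
  [/\ is_subgroup A, forall g, A g -> normal_set Gam1 g -> g = 1
    & A = trivial_subgroup \/ AA A].

Lemma transversal_trivial : transversal_subgroup trivial_subgroup.
Proof. by split; [exact: trivial_subgroupP|move=> g ->|left]. Qed.

Lemma AA_meet A B g : AA A -> AA B \/ B = normal_set Gam1 -> g <> 1 ->
  A g -> B g -> A = B.
Proof.
move=> hA hB /AA_partition[D [_ uD]] Ag Bg.
rewrite -(uD A) ?(uD B) //; split=> //; first by case: hB => [|->]; [right|left].
by right.
Qed.

(** A member of [AA] might coincide with [Gam1]; the element [g] excludes this, and the partition
    does the rest. *)
Lemma transversal_AA A g : AA A -> A g -> ~ normal_set Gam1 g -> transversal_subgroup A.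
Proof.
move=> hA Ag ng; split; [exact: AA_subgroup| |by right].
move=> h Ah h1; apply: contrapT => hn1; apply: ng.
by rewrite -(@AA_meet A (normal_set Gam1) h) //; right.
Qed.

Lemma transversal_conj A c : transversal_subgroup A -> transversal_subgroup (conj_set A c).
Proof.
case=> sA tA [->|hA]; first by rewrite conj_trivial; apply: transversal_trivial.
split; [exact: conj_subgroup| |by right; apply: AA_conj].
move=> g; rewrite conj_setE => Ag g1; apply: (conjg_inj c^-1).
by rewrite conj1g; apply: tA => //; apply: normal_conj.
Qed.

(** A balanced cycle is switched to 1, and a handcuff or theta has too many edges to be balanced, so
    balance over the quotient decides the kind of [A]. *)
Lemma gain_class_transversal C : CC C -> exists A eta,
  [/\ transversal_subgroup A, switched_in A eta C,
     pot phi C (verts C) -> A = trivial_subgroup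
   & ~~ pot phi C (verts C) -> AA A].
Proof.
case=> cC [bal|[shape [eta [A [hA sw]]]]].
  have [eta h] := balanced_switched bal; exists trivial_subgroup, eta; split=> //.
    exact: transversal_trivial.
  case/negP; apply: switched_in_potential (switched_in_le _ h).
  exact: (trivial_sub (normal_is_subgroup Gam1)).
have npot : ~~ pot phi C (verts C).
  have lt : #|verts C| < #|C| by case: shape => [/card_handcuff|/card_theta].
  by have := card_circuit cC; case: (pot _ _ _) => //; move: lt; clear; lia.
have {}sw : switched_in A eta C by move=> o oC; apply: sw; exists o.
exists A, eta; split=> //; last by rewrite (negPf npot).
split; [exact: AA_subgroup| |by right].
(* A common element other than 1 would force [A] to be [Gam1], and [C] would be balanced. *)
move=> g Ag g1; apply: contrapT => gn1; case/negP: npot.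
apply: (@switched_in_potential eta); rewrite -(@AA_meet A (normal_set Gam1) g) //; by right.
Qed.

Lemma transversal_gain_class A eta X C : transversal_subgroup A ->
  switched_in A eta X -> circuit N C -> C \subset X -> CC C.
Proof.
move=> [sA tA cA] sw cC sC; split=> //.
have cnt := card_circuit cC.
case: (circuit_shape cC) => [cyc|shape].
  left; have : pot phi C (verts C).
    by move: cnt; rewrite (card_cycle cyc); case: (pot _ _ _) => //=; clear; lia.
  case/asboolP=> eta' h; case: cyc => w hw; exists w => //.
  have w1 : normal_set Gam1 (walk_gain psi w).
    apply/quotient_map_ker; rewrite -walk_gain_quotient.
    apply: (closed_walk_gain (eta := eta') hw) => o oC; apply: h => //.
    exact: src_verts.
  have /simple_closed_walkP[u [_ hwu _ _ eqC]] := hw.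
  have := switched_in_walk sA sw hwu; rewrite eqC => /(_ sC) wA.
  (* The conjugate of the gain by [eta u] lies in [A] and, by normality, in [Gam1]. *)
  apply: (conjg_inj (eta u)); rewrite conj1g; apply: tA; last exact: normal_conj.
  by rewrite /conjg mulgA.
right; split=> //; exists eta, A; split; last first.
  by move=> g [o oC <-]; apply: sw; apply: (subsetP sC).
(* A trivial [A] would balance [C], which has more edges than vertices. *)
case: cA => // A1.
have : pot phi C (verts C).
  apply: (@switched_in_potential eta); apply: switched_in_sub sC _.
  apply: switched_in_le sw; rewrite A1.
  exact: (trivial_sub (normal_is_subgroup Gam1)).
have lt : #|verts C| < #|C| by case: shape => [/card_handcuff|/card_theta].
by move: cnt lt => + + hp; rewrite hp; clear; lia.
Qed.

(** [C] is connected, so it stays on [verts C1] and hence inside [C1]. *)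
Lemma circuit_disjoint C1 C2 C o : circuit N C1 -> circuit N C ->
  [disjoint verts C1 & verts C2] -> C \subset C1 :|: C2 ->
  oe o \in C -> oe o \in C1 -> C = C1.
Proof.
move=> c1 cC dis /subsetP sC oC o1.
have clV : closed_under C (verts C1).
  move=> o' /sC; rewrite inE => /orP[o'1|o'2]; first by rewrite src_verts // tgt_verts.
  have dis' y : y \in verts C2 -> (y \in verts C1) = false.
    by move=> y2; apply/negP => y1; move/pred0P/(_ y): dis; rewrite /= y1 y2.
  by rewrite !dis' ?src_verts ?tgt_verts.
have [_ m1] := circuitP c1; apply: m1; last by have [] := circuitP cC.
apply/subsetP => e eC; have [o' eqe] := oe_surj e; subst e.
have /orP[//|o'2] : (oe o' \in C1) || (oe o' \in C2) by have := sC _ eC; rewrite inE.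
have : src o' \in vclass C (src o) by rewrite (circuit_connected cC) ?src_verts.
move/(subsetP (vclass_closed clV (src_verts o1))) => o'1.
by move/pred0P/(_ (src o')): dis; rewrite /= o'1 src_verts.
Qed.

(* With b(Y) the number of balanced components, the modularity of the pair
   C1, C2 says b(C1) + b(C2) = b(C1 u C2) + b(C1 n C2), where the components of
   C1 n C2 are counted on all of V(C1) n V(C2). *)
Lemma modular_balanced_classes C1 C2 v : circuit N C1 -> circuit N C2 -> C1 != C2 ->
  #|C1 :|: C2| = (rank N (C1 :|: C2) + 2)%N -> v \in verts C1 :&: verts C2 ->
  (#|balanced_classes_in phi (verts C1 :&: verts C2) (C1 :&: C2)| +
   pot phi (C1 :|: C2) (verts (C1 :|: C2)) =
   pot phi C1 (verts C1) + pot phi C2 (verts C2))%N.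
Proof.
move=> c1 c2 ne nul; rewrite inE => /andP[v1 v2].
have e1 := circuit_connected c1 v1; have e2 := circuit_connected c2 v2.
have eU : verts (C1 :|: C2) = vclass (C1 :|: C2) v.
  apply/eqP; rewrite eqEsubset [X in _ && X]vclass_closed; last 2 first.
  - exact: closed_verts.
  - by rewrite vertsU inE v1.
  rewrite andbT vertsU subUset -{1}e1 -{1}e2.
  by rewrite !vclass_sub ?subsetUl ?subsetUr.
have r1 := frame_rank_connected phi (esym e1).
have r2 := frame_rank_connected phi (esym e2).
have rU := frame_rank_connected phi eU.
have sI : verts (C1 :&: C2) \subset verts C1 :&: verts C2.
  by rewrite subsetI !vertsS ?subsetIl ?subsetIr.
have rI : (rank N (C1 :&: C2) + _ = _)%N := frame_rankE phi (C1 :&: C2).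
have := card_balanced_classes phi sI.
have := circuit_modular c1 c2 ne nul.
have := cardsC (verts C1 :&: verts C2); have := cardsUI (verts C1) (verts C2).
by rewrite -vertsU; move: r1 r2 rU rI; clear; lia.
Qed.

Lemma vclass_setI C1 C2 x : x \in verts C1 :&: verts C2 ->
  vclass (C1 :&: C2) x \subset verts C1 :&: verts C2.
Proof.
apply: vclass_closed => o; rewrite in_setI => /andP[o1 o2].
by rewrite !in_setI !src_verts // !tgt_verts.
Qed.

Lemma mem_balanced_classes_in C1 C2 x : x \in verts C1 :&: verts C2 ->
  pot phi (C1 :&: C2) (vclass (C1 :&: C2) x) ->
  vclass (C1 :&: C2) x \in balanced_classes_in phi (verts C1 :&: verts C2) (C1 :&: C2).
Proof. by move=> xW px; rewrite !in_set imset_f // px vclass_setI. Qed.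

(** * Gluing the switchings of two circuits *)

Section Gluing.
Variables (C1 C2 : {set edge G}) (v : V).
Hypothesis vI : v \in verts C1 :&: verts C2.
Local Notation I := (C1 :&: C2).
Local Notation W := (verts C1 :&: verts C2).

Let switchedI A1 A2 eta1 eta2 : switched_in A1 eta1 C1 -> switched_in A2 eta2 C2 ->
  switched_in A1 eta1 I /\ switched_in A2 eta2 I.
Proof. by split; apply: switched_in_sub; try eassumption; rewrite ?subsetIl ?subsetIr. Qed.

(** Switchings that agree at a vertex of [W] use the same member of [AA]: distinct members meet
    trivially, and [switched_in_meet] would balance the class of that vertex. *)
Lemma glue_unbalanced A1 A2 eta1 eta2 : AA A1 -> AA A2 ->
  transversal_subgroup A1 ->
  switched_in A1 eta1 C1 -> switched_in A2 eta2 C2 ->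
  (forall x, x \in W -> ~~ pot phi I (vclass I x)) ->
  exists A eta, transversal_subgroup A /\ switched_in A eta (C1 :|: C2).
Proof.
move=> hA1 hA2 tA s1 s2 np.
have meet A eta B eta' x : AA A -> AA B -> x \in W -> switched_in A eta C1 ->
    switched_in B eta' C2 -> eta x = eta' x -> A = B.
  move=> hA hB xW h1 h2 eqx; have [k1 k2] := switchedI h1 h2.
  apply: contrapT => nAB; case/negP: (np x xW).
  apply: (switched_in_meet (AA_subgroup hA) (AA_subgroup hB) k1 k2 eqx) => g Ag Bg.
  have [->|/eqP gn1] := eqVneq g 1; first by have [] := normal_is_subgroup Gam1.
  by case: nAB; apply: (@AA_meet A B g) => //; left.
(* Translation by [c] makes the switchings agree at [v] and conjugates [A2]. *)
pose c := (eta2 v)^-1 * eta1 v.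
have s2c := switched_in_shift c s2.
have eqA : A1 = conj_set A2 c.
  apply: (meet A1 eta1 (conj_set A2 c) _ v) s1 s2c _ => //; first exact: AA_conj.
  by rewrite /c mulVKg.
rewrite -eqA in s2c; move: (fun x => _) s2c => eta2' s2c.
have [eta h] : exists eta, switched_in A1 eta (C1 :|: C2).
  apply: (switched_in_glue (AA_subgroup hA1) s1 s2c) => x x1 x2.
  have xW : x \in W by rewrite inE x1.
  (* Translation by [g] makes the switchings agree at [x], so [A1] equals its conjugate by [g]; with
     [g] outside [A1], malnormality makes [A1] trivial and [I] balanced. *)
  apply: contrapT => nA; pose g := ((eta1 x)^-1 * eta2' x)^-1.
  have [A11 AM AV] := AA_subgroup hA1.
  have ng : ~ A1 g by move=> /AV; rewrite invgK.
  have eqAg : A1 = conj_set A1 g.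
    apply: (meet A1 eta1 (conj_set A1 g) _ x) s1 (switched_in_shift g s2c) _ => //.
      exact: AA_conj.
    by rewrite /g invgM invgK mulVKg.
  have tr : forall h, A1 h -> h = 1.
    have mal := AA_malnormal hA1 ng; rewrite -eqAg classical_sets.setIid in mal.
    by move=> h; rewrite mal.
  have [k1 k2] := switchedI s1 s2c.
  case/negP: (np x xW); apply: (@switched_in_potential eta1).
  apply: switched_in_le k1 => h /tr ->; by have [] := normal_is_subgroup Gam1.
by exists A1, eta.
Qed.

(** The trivial subgroup lies in the other one, so a single subgroup serves both circuits; agreement
    at [v] then spreads over [W]. *)
Lemma glue_connected A1 A2 eta1 eta2 :
  transversal_subgroup A1 -> transversal_subgroup A2 ->
  A1 = trivial_subgroup \/ A2 = trivial_subgroup ->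
  switched_in A1 eta1 C1 -> switched_in A2 eta2 C2 ->
  (forall x, x \in W -> x \in vclass I v) ->
  exists A eta, transversal_subgroup A /\ switched_in A eta (C1 :|: C2).
Proof.
move=> t1 t2 triv s1 s2 con.
pose c := (eta2 v)^-1 * eta1 v.
have s2c := switched_in_shift c s2; have t2c := transversal_conj c t2.
have [A [tA h1 h2]] : exists A, [/\ transversal_subgroup A, switched_in A eta1 C1
    & switched_in A (fun x => eta2 x * c) C2].
  case: triv => eqA; [exists (conj_set A2 c)|exists A1]; split=> //.
    by apply: switched_in_le s1; rewrite eqA; apply: trivial_sub; case: t2c.
  apply: switched_in_le s2c; rewrite eqA conj_trivial.
  by apply: trivial_sub; case: t1.
have [sA _ _] := tA; have [A11 _ _] := sA; have [k1 k2] := switchedI h1 h2.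
have [eta h] : exists eta, switched_in A eta (C1 :|: C2); last by exists A, eta.
apply: (switched_in_glue sA h1 h2) => x x1 x2.
apply: (switched_in_connected sA k1 k2 (u := v)).
  by rewrite /c mulVKg mulVg.
by apply: con; rewrite inE x1.
Qed.

Lemma glue_balanced eta1 eta2 :
  switched_in trivial_subgroup eta1 C1 -> switched_in trivial_subgroup eta2 C2 ->
  ~~ pot phi (C1 :|: C2) (verts (C1 :|: C2)) ->
  #|balanced_classes_in phi W I| <= 2 ->
  exists A eta, transversal_subgroup A /\ switched_in A eta (C1 :|: C2).
Proof.
move=> s1 s2 npU le2; pose c := (eta2 v)^-1 * eta1 v.
have := switched_in_shift c s2; rewrite conj_trivial => {}s2.
set eta2' := fun x => _ in s2.
have eqv : eta2' v = eta1 v by rewrite /eta2' /c mulVKg.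
move: eta2' s2 eqv => {c} {}eta2 s2 eqv.
(* Both switchings make the gains on [I] trivial, so the discrepancy is constant on each class of
   [I]. *)
pose df x := (eta1 x)^-1 * eta2 x.
have [k1 k2] := switchedI s1 s2; have sT := trivial_subgroupP.
have dfI x y : y \in vclass I x -> df y = df x.
  move=> yx; have := switched_in_shift (df x)^-1 k2; rewrite conj_trivial => k2'.
  have := switched_in_connected sT k1 k2' _ yx.
  rewrite /trivial_subgroup /= mulgA mulgV => /(_ erefl).
  by rewrite mulgA => /(canRL (mulgK _)); rewrite mul1g invgK.
have [all1|] := pselect (forall x, x \in W -> df x = 1).
  have [eta h] : exists eta, switched_in trivial_subgroup eta (C1 :|: C2).
    by apply: (switched_in_glue sT s1 s2) => x x1 x2; apply: all1; rewrite inE x1.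
  by exists trivial_subgroup, eta; split=> //; apply: transversal_trivial.
move=> /existsNP[x /not_implyP[xW dx]].
have dv : df v = 1 by rewrite /df eqv mulVg.
(* Otherwise [v], [x] and [y] would lie in three distinct balanced classes. *)
have two y : y \in W -> df y = 1 \/ df y = df x.
  move=> yW; have [yv|nyv] := boolP (y \in vclass I v).
    by left; rewrite (dfI _ _ yv).
  have [yx|nyx] := boolP (y \in vclass I x); first by right; apply: dfI.
  have potI z : pot phi I (vclass I z).
    apply: (@switched_in_potential eta1); apply: switched_in_le k1.
    exact: (trivial_sub (normal_is_subgroup Gam1)).
  have ne a b : b \notin vclass I a -> vclass I a != vclass I b.
    by apply: contra => /eqP->; apply: mem_vclass.
  have nxv : x \notin vclass I v by apply/negP => /dfI; rewrite dv.
  have sub : vclass I y |: [set vclass I v; vclass I x] \subset balanced_classes_in phi W I.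
    by rewrite subUset sub1set subUset !sub1set !mem_balanced_classes_in.
  have := leq_trans (subset_leq_card sub) le2.
  rewrite cardsU1 cards2 ne // in_set2 !(eq_sym (vclass I y)).
  by rewrite (negPf (ne _ _ nyv)) (negPf (ne _ _ nyx)).
have glue A : is_subgroup A -> A (df x) -> exists eta, switched_in A eta (C1 :|: C2).
  move=> sA Ax; have tA := trivial_sub sA.
  apply: (switched_in_glue sA (switched_in_le tA s1) (switched_in_le tA s2)) => y y1 y2.
  have yW : y \in W by rewrite inE y1.
  by case: (two y yW); rewrite /df => ->//; case: sA.
(* Gluing into [Gam1] would balance the union, so the part containing [df x] comes from [AA]. *)
have n1 : ~ normal_set Gam1 (df x).
  move=> h; have [eta sw] := glue _ (normal_is_subgroup Gam1) h.
  by case/negP: npU; apply: switched_in_potential sw.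
have [A [[hA Ax] _]] := AA_partition dx.
case: hA => [eqA|hA]; first by case: n1; rewrite -eqA.
have tA := transversal_AA hA Ax n1.
have [eta sw] := glue A (AA_subgroup hA) Ax; by exists A, eta.
Qed.

End Gluing.

Lemma gain_class_linear : linear_class N CC.
Proof.
split=> [C []//|C1 C2 h1 h2 nul C cC sC].
have [c1 _] := h1; have [c2 _] := h2.
have [e12|ne] := eqVneq C1 C2.
  suff -> : C = C1 by [].
  have [_ m1] := circuitP c1; apply: m1; last by have [] := circuitP cC.
  by rewrite -e12 setUid in sC.
have [dis|] := boolP [disjoint verts C1 & verts C2].
  have [o oC] := circuit_nonempty cC.
  have := subsetP sC _ oC; rewrite inE => /orP[o1|o2].
    by rewrite (circuit_disjoint c1 cC dis sC oC o1).
  rewrite disjoint_sym in dis; rewrite setUC in sC.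
  by rewrite (circuit_disjoint c2 cC dis sC oC o2).
rewrite -setI_eq0 => /set0Pn[v vW].
have [A1 [eta1 [t1 s1 b1 u1]]] := gain_class_transversal h1.
have [A2 [eta2 [t2 s2 b2 u2]]] := gain_class_transversal h2.
suff [A [eta [tA sw]]] : exists A eta,
    transversal_subgroup A /\ switched_in A eta (C1 :|: C2).
  exact: transversal_gain_class tA sw cC sC.
have := modular_balanced_classes c1 c2 ne nul vW.
set W := verts C1 :&: verts C2; set I := C1 :&: C2.
have sub1 : pot phi (C1 :|: C2) (verts (C1 :|: C2)) -> pot phi C1 (verts C1).
  by apply: pot_sub; rewrite ?vertsS ?subsetUl.
have sub2 : pot phi (C1 :|: C2) (verts (C1 :|: C2)) -> pot phi C2 (verts C2).
  by apply: pot_sub; rewrite ?vertsS ?subsetUr.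
(* When one circuit is balanced, so is every class of the intersection; a single balanced class is
   then the only class on [W]. *)
have one : pot phi C1 (verts C1) \/ pot phi C2 (verts C2) ->
    #|balanced_classes_in phi W I| = 1%N -> forall x, x \in W -> x \in vclass I v.
  move=> p12 /eqP/cards1P[S eqS] x xW.
  have inS y : y \in W -> vclass I y = S.
    move=> yW; apply/set1P; rewrite -eqS mem_balanced_classes_in //.
    have sW := vclass_setI yW.
    by case: p12; apply: pot_sub; rewrite ?subsetIl ?subsetIr //;
       apply: subset_trans sW _; rewrite ?subsetIl ?subsetIr.
  by rewrite (inS v) // -(inS x) // mem_vclass.
case p1: (pot phi C1 _) sub1 b1 u1 one => sub1 b1 u1 one;
case p2: (pot phi C2 _) sub2 b2 u2 one => sub2 b2 u2 one.
(* The count leaves one class if the union is balanced and two otherwise. *)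
- have := b1 isT => ?; have := b2 isT => ?; subst A1 A2.
  case pU: (pot phi (C1 :|: C2) _) => cnt.
    apply: (glue_connected (v := v) t1 t2 _ s1 s2); first by left.
    by apply: one; [left|move: cnt; clear; lia].
  by apply: (glue_balanced vW s1 s2); [rewrite pU|move: cnt; rewrite /W /I; clear; lia].
(* A balanced union would balance both circuits, so the count leaves exactly one class. *)
- case pU: (pot phi (C1 :|: C2) _) => cnt; first by have := sub2 pU.
  apply: (glue_connected (v := v) t1 t2 _ s1 s2); first by left; apply: b1.
  by apply: one; [left|move: cnt; clear; lia].
- case pU: (pot phi (C1 :|: C2) _) => cnt; first by have := sub1 pU.
  apply: (glue_connected (v := v) t1 t2 _ s1 s2); first by right; apply: b2.
  by apply: one; [right|move: cnt; clear; lia].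
move=> cnt; apply: (glue_unbalanced vW (u1 isT) (u2 isT) t1 s1 s2) => x xW.
apply/negP => /(mem_balanced_classes_in xW).
suff -> : balanced_classes_in phi W I = set0 by rewrite inE.
by apply/eqP; rewrite -cards_eq0; move: cnt; clear; lia.
Qed.

End GainClass.

Theorem theorem3p3 (Gam : groupType) (Gam1 : normal_subgroup Gam)
    (AA : set (set Gam)) (G : mgraph) (psi : gain Gam G)
    (AA_subgroup : forall A : set Gam, AA A -> is_subgroup A)
    (AA_partition : group_partition
       ([set normal_set Gam1] `|` AA)%classic)
    (AA_malnormal : forall A : set Gam, AA A -> malnormal A)
    (AA_conj : forall (A : set Gam) (g : Gam), AA A -> AA (conj_set A g)) :
  linear_class (frame_matroid (quotient_gain psi Gam1))
    (gain_class Gam1 AA psi) /\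
  exists M : matroid (edge G),
    rank M =1 lift_rank (frame_matroid (quotient_gain psi Gam1))
                (gain_class Gam1 AA psi) /\
    elementary_lift M (frame_matroid (quotient_gain psi Gam1)).
Proof.
have lin := gain_class_linear psi AA_subgroup AA_partition AA_malnormal AA_conj.
split=> //; exists (lift_matroid lin); split=> //.
exact: lift_matroid_elementary.
Qed.
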